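(* Consider the adapt-then-combine diffusion strategy over a weakly-connected network as described in the context, with step-sizes $\mu_k=\tau_k\mu_{\max}$ ($0<\tau_k\le 1$ fixed). Assume each $J_k$ is convex (and twice differentiable with uniformly bounded Hessian), that in each sub-network $s$ of group $S$ at least one cost $J_{s,k}$ is strongly convex, and that the gradient noise satisfies the first- and second-order moment conditions stated in the context. Then, for sufficiently small step-sizes, the network is mean-square stable: for every agent $k$, $$\limsup_{i\to\infty}\mathbb{E}\|w_k^\star-\boldsymbol{w}_{k,i}\|^2=O(\mu_{\max}),$$ where $w_k^\star$ is the limit point of agent $k$ defined in the context.
   Context: Network: $N$ agents partitioned into sub-networks $1,\dots,S+R$; agents of sub-networks $1,\dots,S$ (group $S$, $N_{gS}$ agents) numbered first, then those of $S+1,\dots,S+R$ (group $R$). Combination matrix $A=[a_{\ell k}]$ nonnegative, left-stochastic, $a_{\ell k}=0$ unless $\ell\in\mathcal{N}_k$ (neighborhood of $k$, containing $k$), of block form $A=\begin{bmatrix}T_{SS}&T_{SR}\\0&T_{RR}\end{bmatrix}$ with $T_{SS}=\mathrm{blockdiag}\{A_1,\dots,A_S\}$, each $A_s\in\mathbb{R}^{N_s\times N_s}$ left-stochastic primitive with Perron vector $p_s$ ($A_sp_s=p_s$, $\mathbb{1}^{\mathsf T}p_s=1$, $p_s\succ 0$), and $T_{RR}$ block upper triangular with diagonal blocks $A_r$ ($r=S+1,\dots,S+R$), each the nonnegative irreducible matrix of internal weights of a connected sub-network that receives information from outside it (some column of $A_r$ sums to less than one). Let $W=T_{SR}(I-T_{RR})^{-1}$.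 Algorithm: agent $k$ has cost $J_k:\mathbb{R}^M\to\mathbb{R}$ and runs $\boldsymbol{\psi}_{k,i}=\boldsymbol{w}_{k,i-1}-\mu_k\widehat{\nabla_{w^{\mathsf T}}J_k}(\boldsymbol{w}_{k,i-1})$, $\boldsymbol{w}_{k,i}=\sum_{\ell\in\mathcal{N}_k}a_{\ell k}\boldsymbol{\psi}_{\ell,i}$, where the stochastic gradient approximation defines the gradient noise $\boldsymbol{s}_{k,i}(\boldsymbol{w}_{k,i-1})=\widehat{\nabla_{w^{\mathsf T}}J_k}(\boldsymbol{w}_{k,i-1})-\nabla_{w^{\mathsf T}}J_k(\boldsymbol{w}_{k,i-1})$; $\mathcal{F}_{i-1}$ is the filtration generated by $\{\boldsymbol{w}_{\ell,j}: j\le i-1,\ \ell=1,\dots,N\}$. Limit points: for agent $k$ in sub-network $s\le S$ with agents' step-sizes $\mu_{s,k}$ and costs $J_{s,k}$, set $q_{s,k}=\mu_{s,k}p_{s,k}$ and let $w_s^\star$ be the unique solution of $\sum_{k=1}^{N_s}q_{s,k}\nabla_{w^{\mathsf T}}J_{s,k}(w_s^\star)=0$; $w_k^\star=w_s^\star$ for such agents. With $\omega^\star=\mathrm{col}\{\mathbb{1}_{N_1}\otimes w_1^\star,\dots,\mathbb{1}_{N_S}\otimes w_S^\star\}$, the limit points $w_k^\star$ of the group-$R$ agents (in agent order) are the $M$-blocks of $(W\otimes I_M)^{\mathsf T}\omega^\star$. Gradient noise conditions: for all $k,i$, $\mathbb{E}[\boldsymbol{s}_{k,i}(\boldsymbol{w}_{k,i-1})\mid\mathcal{F}_{i-1}]=0$,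 the noises of different agents are conditionally uncorrelated given $\mathcal{F}_{i-1}$, and $\mathbb{E}[\|\boldsymbol{s}_{k,i}(\boldsymbol{w}_{k,i-1})\|^2\mid\mathcal{F}_{i-1}]\le\beta_k^2\|w_k^\star-\boldsymbol{w}_{k,i-1}\|^2+\sigma_k^2$ for some constants $\beta_k^2,\sigma_k^2\ge 0$. ''For sufficiently small step-sizes, $X=O(\mu_{\max})$'' means there are $\bar\mu>0$ and $c$ independent of $\mu_{\max}$ with $X\le c\mu_{\max}$ for all $\mu_{\max}<\bar\mu$.
   Formalization: The initial iterates are assumed to be random vectors with finite second moment; without this the mean-square error can be infinite at every time (e.g. one agent, quadratic cost, no noise, Cauchy-distributed start). *)

(* Defs.v *)
From HB Require Import structures.
From mathcomp Require Import all_boot all_order all_algebra.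
From mathcomp Require Import all_classical all_reals all_analysis.
Set Implicit Arguments. Unset Strict Implicit. Unset Printing Implicit Defensive.
Import Order.TTheory GRing.Theory Num.Theory.
Import numFieldNormedType.Exports.
Local Open Scope classical_set_scope.
Local Open Scope ring_scope.

Section Defs.
Variable R : realType.

Definition sqnorm (M : nat) (v : 'rV[R]_M) : R := \sum_(j < M) (v ord0 j) ^+ 2.

Definition grad (M : nat) (J : 'rV[R]_M -> R) (x : 'rV[R]_M) : 'rV[R]_M :=
  \row_(j < M) ('D_(delta_mx ord0 j) J x).

Definition hess (M : nat) (J : 'rV[R]_M -> R) (x : 'rV[R]_M) : 'M[R]_M :=
  \matrix_(i < M, j < M) ('D_(delta_mx ord0 i) (grad J) x) ord0 j.

Definition convex_fun (M : nat) (J : 'rV[R]_M -> R) : Prop :=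
  forall x y (t : R), 0 <= t <= 1 ->
    J (t *: x + (1 - t) *: y) <= t * J x + (1 - t) * J y.

Definition strongly_convex_fun (M : nat) (J : 'rV[R]_M -> R) : Prop :=
  exists nu : R, 0 < nu /\ forall x y (t : R), 0 <= t <= 1 ->
    J (t *: x + (1 - t) *: y) <=
      t * J x + (1 - t) * J y - nu / 2 * t * (1 - t) * sqnorm (x - y).

Definition twice_diff_bounded_hessian (M : nat) (J : 'rV[R]_M -> R) : Prop :=
  (forall x, differentiable J x) /\ (forall x, differentiable (grad J) x) /\
  exists lam : R, forall x, `| hess J x | <= lam.

(* zero-padded diagonal block of the (square) matrix A associated with
   the agents of sub-network s (sub-network labelling g) *)
Definition block_of (N : nat) (g : 'I_N -> nat) (A : 'M[R]_N) (s : nat) : 'M[R]_N :=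
  \matrix_(l < N, k < N) (if (g l == s) && (g k == s) then A l k else 0).

Definition primitive_block (N : nat) (g : 'I_N -> nat) (A : 'M[R]_N) (s : nat) : Prop :=
  exists m : nat, forall l k, g l = s -> g k = s -> 0 < (block_of g A s ^+ m.+1) l k.

Definition irreducible_block (N : nat) (g : 'I_N -> nat) (A : 'M[R]_N) (s : nat) : Prop :=
  forall l k, g l = s -> g k = s -> exists m : nat, 0 < (block_of g A s ^+ m) l k.

Definition receives_from_outside (N : nat) (g : 'I_N -> nat) (A : 'M[R]_N) (s : nat) : Prop :=
  exists k, g k = s /\ \sum_(l < N | g l == s) A l k < 1.

Definition filtration (d : measure_display) (T : measurableType d) (N M : nat)
    (w : nat -> 'I_N -> T -> 'rV[R]_M) (i : nat) : set (set T) :=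
  <<s [set E | exists j l m (B : set R),
          (j <= i)%N /\ measurable B /\ E = (fun x => w j l x ord0 m) @^-1` B] >>.

End Defs.

Section LimitPoints.
Variable R : realType.
Local Open Scope ring_scope.

Definition Wmat (NS NR : nat) (A : 'M[R]_(NS + NR)) : 'M[R]_(NS, NR) :=
  ursubmx A *m invmx (1%:M - drsubmx A).

(* limit points: w_k^* = w_s^* for agents of group S (in sub-network s = g k);
   for group R agents, the M-blocks of (W (x) I_M)^T omega^* *)
Definition diff_limit_point (M NS NR : nat) (g : 'I_(NS + NR) -> nat)
    (A : 'M[R]_(NS + NR)) (wS : nat -> 'rV[R]_M) (k : 'I_(NS + NR)) : 'rV[R]_M :=
  match fintype.split k with
  | inl _ => wS (g k)
  | inr j => \sum_(i < NS) Wmat A i j *: wS (g (lshift NR i))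
  end.
End LimitPoints.

(* Main.v *)
(* Inside a sub-network s of group S, the centroid of the iterates, weighted by the
   Perron vector, performs a stochastic gradient step on a strongly convex aggregate
   cost.  The noise is orthogonal to the past, so it adds only O(mu^2) to the mean
   square error of the centroid, which otherwise contracts by 1 - a mu / 2, up to
   mu times the mean square disagreement between agents.
   The disagreements and the errors in group R are controlled without spectral
   theory.  By convexity of the squared norm, E|w_k - w_l|^2 is averaged by two
   independent copies of the chain with transition weights A, for which the diagonal
   is absorbing; and since w*_k = sum_l a_lk w*_l for all k, E|w*_k - w_k|^2 is
   averaged by A itself, for which group S is absorbing.  Each of the two chains has
   a potential u, vanishing on the absorbing set and bounded below elsewhere, with
   u A <= rho u for some rho < 1.  Bounds C on the centroid errors, D u on the
   disagreements and Y u on the errors in group R thus follow a coupled affine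
   recursion in (C, D, Y) with limit superior O(mu). *)
Require Import Defs.
From HB Require Import structures.
From mathcomp Require Import all_boot all_order all_algebra.
From mathcomp Require Import all_classical all_reals all_analysis.
From mathcomp Require Import measurable_realfun ring lra.
Set Implicit Arguments.
Unset Strict Implicit.
Unset Printing Implicit Defensive.
Import Order.TTheory GRing.Theory Num.Theory.
Import numFieldNormedType.Exports.
Local Open Scope classical_set_scope.
Local Open Scope ring_scope.
(** * Integration against centred noise *)

Section Martingale.
Context d (T : measurableType d) (R : realType) (P : probability T R).

Import HBNNSimple.

(** Conditional centring of [X] is expressed by its integrals over the sets of [<<s G>>]. Hence [X]
    is orthogonal to simple functions for [<<s G>>]; those increasing to [h] give the claim by
    convergence dominated by [|h X|]. *)
Lemma ge0_martingale_orth (G : set (set T)) (X : T -> R)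
    (h : g_sigma_algebraType G -> R) :
  (forall E, G E -> measurable E) ->
  P.-integrable setT (EFin \o X) ->
  (forall E, <<s G >> E -> (\int[P]_(x in E) (X x)%:E = 0)%E) ->
  measurable_fun setT h -> (forall x, 0 <= h x) ->
  P.-integrable setT (fun x => (h x * X x)%:E) ->
  (\int[P]_x (h x * X x)%:E = 0)%E.
Proof.
move=> GT iX X0 mh h0 ihX.
have sGT E : <<s G >> E -> measurable E.
  by move=> /(_ measurable); apply; split => //; exact: sigma_algebra_measurable.
have mEh : measurable_fun [set: g_sigma_algebraType G] (EFin \o h).
  exact/measurable_EFinP.
pose phi n : {nnsfun g_sigma_algebraType G >-> R} := nnsfun_approx measurableT mEh n.
have phi_cvg x : (phi n x)%:E @[n --> \oo] --> (h x)%:E.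
  by apply: (@cvg_nnsfun_approx _ _ _ _ measurableT _ mEh) => // y _; rewrite lee_fin.
have phi_cvgR x : phi n x @[n --> \oo] --> h x.
  exact: (fine_cvg (phi_cvg x)).
have phi_nd x : nondecreasing_seq (phi ^~ x).
  by move=> m n mn; have /lefP := nd_nnsfun_approx measurableT mEh mn; apply.
have phi_le n x : phi n x <= h x.
  rewrite -(cvg_lim (@Rhausdorff R) (phi_cvgR x)).
  by apply: nondecreasing_cvgn_le => //; apply/cvg_ex; exists (h x).
have mphi n : measurable_fun [set: T] (phi n).
  move=> _ Y mY; rewrite setTI; apply: sGT.
  by have := @measurable_funPTI _ _ _ _ (phi n) _ mY.
have phi_int n : (\int[P]_x (phi n x * X x)%:E = 0)%E.
  set s := finmap.enum_fset (fset_set (range (phi n))).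
  have mE i : @measurable _ T (phi n @^-1` [set s`_i]).
    by rewrite -[X in measurable X]setTI; exact: (mphi n measurableT _ (measurable_set1 _)).
  have iE i : P.-integrable setT (fun x => (\1_(phi n @^-1` [set s`_i]) x * X x)%:E).
    under eq_fun do rewrite EFinM.
    apply: (@integrableMr _ _ _ _ _ _ _ (EFin \o X)) => //.
    exists 1; split => // M M1 x _ /=; rewrite ger0_norm// indicE.
    by case: (_ \in _); rewrite /= ?mulr1n ?mulr0n ltW// (lt_trans _ M1).
  under eq_integral => x _.
    rewrite fimfunEord -/s mulr_suml -sumEFin.
    under eq_bigr do rewrite -mulrA EFinM.
    over.
  rewrite /= integral_sum//; last by move=> i; apply: integrableZl.
  rewrite big1 // => i _; rewrite integralZl//.
  rewrite (_ : (\int[P]_x _ = 0)%E) ?mule0//.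
  have <- := X0 (phi n @^-1` [set s`_i]); last first.
    exact: (@measurable_funPTI _ _ _ _ (phi n) _ (measurable_set1 s`_i)).
  rewrite [RHS]integral_mkcond; apply: eq_integral => x _.
  rewrite /patch indicE; case: ifPn => //= _; rewrite ?mulr1n ?mul1r//.
  by rewrite mulr0n mul0r.
have mX : measurable_fun [set: T] X by move/integrableP : iX => [/measurable_EFinP].
have mh' : measurable_fun [set: T] h.
  move=> _ Y mY; apply: sGT; exact: (mh measurableT).
have cvgP : \forall x \ae P, setT x -> (phi n x * X x)%:E @[n --> \oo] --> (h x * X x)%:E.
  apply: aeW => x _; apply: cvg_EFin; first exact: nearW.
  by apply: cvgMl; exact: phi_cvgR.
have [||||_ _ +] := @dominated_convergence _ _ _ P _ measurableT
  (fun n x => (phi n x * X x)%:E) (fun x => (h x * X x)%:E)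
  (fun x => `|h x * X x|%:E) _ _ cvgP.
- by move=> n; apply/measurable_EFinP; exact: measurable_funM.
- by apply/measurable_EFinP; exact: measurable_funM.
- exact: (integrable_norm ihX).
- apply: aeW => x n _; rewrite /= lee_fin !normrM ler_wpM2r//.
  by rewrite !ger0_norm.
rewrite (_ : [sequence _]_n = cst 0%E); last by apply/funext => n /=; rewrite phi_int.
by move/cvg_lim => <- //; rewrite lim_cst.
Qed.

(** Positive and negative parts of [h] are both dominated by [|h|], so their products with [X] stay
    integrable. *)
Lemma martingale_orth (G : set (set T)) (X : T -> R)
    (h : g_sigma_algebraType G -> R) :
  (forall E, G E -> measurable E) ->
  P.-integrable setT (EFin \o X) ->
  (forall E, <<s G >> E -> (\int[P]_(x in E) (X x)%:E = 0)%E) ->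
  measurable_fun setT h ->
  P.-integrable setT (fun x => (h x * X x)%:E) ->
  (\int[P]_x (h x * X x)%:E = 0)%E.
Proof.
move=> GT iX X0 mh ihX.
have sGT E : <<s G >> E -> measurable E.
  by move=> /(_ measurable); apply; split => //; exact: sigma_algebra_measurable.
have mX : measurable_fun [set: T] X by move/integrableP : iX => [/measurable_EFinP].
pose hp x := Num.max (h x) 0.
pose hn x := Num.max (- h x) 0.
have hE x : h x = hp x - hn x.
  by rewrite /hp /hn; case: (leP (h x) 0) => ?; case: (leP (- h x) 0) => ?; lra.
have mhp : measurable_fun [set: g_sigma_algebraType G] hp.
  exact: measurable_maxr.
have mhn : measurable_fun [set: g_sigma_algebraType G] hn.
  by apply: measurable_maxr => //; exact: measurableT_comp.
have mT (f : g_sigma_algebraType G -> R) : measurable_fun setT f ->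
    measurable_fun [set: T] f.
  move=> mf _ Y mY; apply: sGT; exact: (mf measurableT).
have ip (f : T -> R) : measurable_fun [set: T] f -> (forall x, `|f x| <= `|h x|) ->
    P.-integrable setT (fun x => (f x * X x)%:E).
  move=> mf fh; apply: le_integrable ihX => //.
    by apply/measurable_EFinP; exact: measurable_funM.
  by move=> x _; rewrite /= lee_fin !normrM ler_wpM2r.
have ihp : P.-integrable setT (fun x => (hp x * X x)%:E).
  apply: ip; first exact: mT.
  by move=> x; rewrite /hp; case: (leP (h x) 0) => ?; rewrite ?normr0.
have ihn : P.-integrable setT (fun x => (hn x * X x)%:E).
  apply: ip; first exact: mT.
  by move=> x; rewrite /hn; case: (leP (- h x) 0) => ?; rewrite ?normr0 ?normrN.
under eq_integral do rewrite hE mulrBl EFinB.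
rewrite (@integralB _ _ _ P _ measurableT _ _ ihp ihn).
rewrite !(ge0_martingale_orth GT iX X0) ?subee//.
- by move=> x; rewrite /hn le_max lexx orbT.
- by move=> x; rewrite /hp le_max lexx orbT.
Qed.
End Martingale.

(** * Measurability of continuous functions of random vectors *)

Section ContinuousMeasurable.
Context d (T : measurableType d) (R : realType) (M : nat).

(* [f \o w] is the pointwise limit of [f] at the truncations of [w] to multiples of
   [1 / n], which take countably many values. *)
Lemma measurable_continuous_rV (f : 'rV[R]_M -> R) (w : T -> 'rV[R]_M) :
  continuous f -> (forall j, measurable_fun setT (fun x => w x ord0 j)) ->
  measurable_fun setT (f \o w).
Proof.
move=> cf mw.
pose pt n (v : 'rV[int]_M) : 'rV[R]_M := \row_j ((v ord0 j)%:~R / n.+1%:R).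
pose fl n x : 'rV[int]_M := \row_j Num.floor (n.+1%:R * w x ord0 j).
have mfl n v : measurable [set x | fl n x = v].
  rewrite (_ : [set x | _] = \bigcap_(j in [set: 'I_M])
      (fun x => n.+1%:R * w x ord0 j) @^-1` `[(v ord0 j)%:~R, (v ord0 j + 1)%:~R[%classic).
    apply: fin_bigcap_measurable => [|j _]; first exact: finite_finset.
    rewrite -[X in measurable X]setTI.
    by apply: measurable_funM => //; exact: measurable_itv.
  apply/seteqP; split => x /=.
    by move=> <- j _ /=; rewrite in_itv/= mxE floor_itv.
  move=> H; apply/rowP => j; rewrite mxE; apply/floor_def.
  by have := H j I; rewrite /= in_itv.
apply: (@measurable_fun_cvg _ _ _ _ (fun n x => f (pt n (fl n x)))).
  move=> n _ Y mY; rewrite setTI.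
  rewrite (_ : _ @^-1` _ = \bigcup_(v in [set: 'rV[int]_M])
      (if `[< Y (f (pt n v)) >] then [set x | fl n x = v] else set0)).
    by apply: countable_bigcupT_measurable => // v; case: ifP.
  apply/seteqP; split => x /=.
    by move=> Yx; exists (fl n x) => //; rewrite asboolT.
  by move=> [v _]; case: asboolP => // Yv /= ->.
move=> x _; apply: (@cvg_comp _ _ _ (fun n => pt n (fl n x)) f _ (nbhs (w x))); last exact: cf.
apply/cvg_ballP => e e0; near=> n; split => // i j.
rewrite (ord1 i) !mxE /ball /=.
have n0 : 0 < n.+1%:R :> R by rewrite ltr0n.
have ne : n.+1%:R^-1 < e by near: n; exact: (near_infty_natSinv_lt (PosNum e0)).
have /andP[f1 f2] := floor_itv (n.+1%:R * w x ord0 j).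
set F := Num.floor _ in f1 f2 *.
have -> : w x ord0 j - F%:~R / n.+1%:R = (n.+1%:R * w x ord0 j - F%:~R) / n.+1%:R.
  by field; rewrite lt0r_neq0.
rewrite normrM ger0_norm ?subr_ge0// ger0_norm ?invr_ge0 ?ltW//.
apply: le_lt_trans ne; rewrite ler_piMl ?invr_ge0 ?ltW//.
by move: f2; rewrite intrD => f2; lra.
Unshelve. all: by end_near.
Qed.
End ContinuousMeasurable.
(** * Gradients of smooth convex functions *)

Section Dot.
Variables (R : realType) (M : nat).
Implicit Types u v w : 'rV[R]_M.

Definition dot u v : R := \sum_(j < M) u ord0 j * v ord0 j.

Lemma sqnormE v : sqnorm v = dot v v.
Proof. by apply: eq_bigr => j _; rewrite expr2. Qed.

Lemma sqnorm_ge0 v : 0 <= sqnorm v.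
Proof. by apply: sumr_ge0 => j _; exact: sqr_ge0. Qed.

Lemma sqnorm0 : sqnorm (0 : 'rV[R]_M) = 0.
Proof. by rewrite /sqnorm big1// => j _; rewrite mxE expr0n. Qed.

Lemma sqnorm_eq0 v : sqnorm v <= 0 -> v = 0.
Proof.
move=> v0; have /eqP : sqnorm v = 0 by apply/eqP; rewrite eq_le v0 sqnorm_ge0.
rewrite psumr_eq0 => [|j _]; last exact: sqr_ge0.
move/allP => v0'; apply/rowP => j; rewrite mxE.
by apply/eqP; rewrite -sqrf_eq0; apply: v0'; rewrite mem_index_enum.
Qed.

Lemma sqnormN v : sqnorm (- v) = sqnorm v.
Proof. by apply: eq_bigr => j _; rewrite mxE sqrrN. Qed.

Lemma sqnormB u v : sqnorm (u - v) = sqnorm (v - u).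
Proof. by rewrite -sqnormN opprB. Qed.

Lemma sqnormZ a v : sqnorm (a *: v) = a ^+ 2 * sqnorm v.
Proof. by rewrite /sqnorm mulr_sumr; apply: eq_bigr => j _; rewrite mxE exprMn. Qed.

Lemma dotDr u v w : dot u (v + w) = dot u v + dot u w.
Proof. by rewrite -big_split; apply: eq_bigr => j _; rewrite mxE mulrDr. Qed.

Lemma dotZr a u v : dot u (a *: v) = a * dot u v.
Proof. by rewrite mulr_sumr; apply: eq_bigr => j _; rewrite mxE mulrCA. Qed.

Lemma dotNr u v : dot u (- v) = - dot u v.
Proof. by rewrite -scaleN1r dotZr mulN1r. Qed.

Lemma dotC u v : dot u v = dot v u.
Proof. by apply: eq_bigr => j _; rewrite mulrC. Qed.

Lemma dot0r u : dot u 0 = 0.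
Proof. by rewrite -(scale0r 0) dotZr mul0r. Qed.

Lemma dot_sumr (I : finType) (F : I -> 'rV[R]_M) u :
  dot u (\sum_i F i) = \sum_i dot u (F i).
Proof.
rewrite exchange_big; apply: eq_bigr => j _ /=.
by rewrite summxE mulr_sumr.
Qed.

Lemma sqnormD u v : sqnorm (u + v) = sqnorm u + 2 * dot u v + sqnorm v.
Proof.
rewrite /sqnorm /dot mulr_sumr -!big_split; apply: eq_bigr => j _ /=.
by rewrite mxE; ring.
Qed.

Lemma sqnormD_le t u v : 0 < t ->
  sqnorm (u + v) <= (1 + t) * sqnorm u + (1 + t^-1) * sqnorm v.
Proof.
move=> t0; rewrite /sqnorm !mulr_sumr -big_split; apply: ler_sum => j _ /=.
rewrite mxE -subr_ge0; set a := u _ _; set b := v _ _.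
have -> : (1 + t) * a ^+ 2 + (1 + t^-1) * b ^+ 2 - (a + b) ^+ 2 = t^-1 * (t * a - b) ^+ 2.
  by field; rewrite gt_eqF.
by rewrite mulr_ge0 ?invr_ge0 ?sqr_ge0 ?ltW.
Qed.

Lemma sqnormD2_le u v : sqnorm (u + v) <= 2 * sqnorm u + 2 * sqnorm v.
Proof. by have := @sqnormD_le 1 u v ltr01; rewrite invr1. Qed.

(** With [m] the weighted sum, expand the nonnegative sum of [a i * sqnorm (F i - m)]: the cross
    terms give [- 2 * sqnorm m], and a total weight at most 1 gives back at most [sqnorm m]. *)
Lemma sqnorm_sum_le (I : finType) (a : I -> R) (F : I -> 'rV[R]_M) :
  (forall i, 0 <= a i) -> \sum_i a i <= 1 ->
  sqnorm (\sum_i a i *: F i) <= \sum_i a i * sqnorm (F i).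
Proof.
move=> a0 a1; set m := \sum_i a i *: F i.
have : 0 <= \sum_i a i * sqnorm (F i - m).
  by apply: sumr_ge0 => i _; rewrite mulr_ge0 ?sqnorm_ge0.
under eq_bigr => i _ do rewrite sqnormD sqnormN dotNr !mulrDr mulrA.
rewrite !big_split /= -mulr_suml => H.
have E : \sum_i a i * 2 * - dot (F i) m = - 2 * sqnorm m.
  rewrite {2}/m sqnormE dot_sumr mulr_sumr; apply: eq_bigr => i _.
  by rewrite dotZr dotC; ring.
rewrite E in H; have := ler_wpM2r (sqnorm_ge0 m) a1; lra.
Qed.

End Dot.

Section Calculus.
Variables (R : realType) (M : nat).
Implicit Types (J : 'rV[R]_M -> R) (x y v : 'rV[R]_M).

Lemma derive_sum_delta (f : 'rV[R]_M -> R) x v : differentiable f x ->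
  'D_v f x = \sum_j v ord0 j * 'D_(delta_mx ord0 j) f x.
Proof.
move=> df; rewrite deriveE// {1}(row_sum_delta v) linear_sum.
by apply: eq_bigr => j _; rewrite linearZ /= deriveE.
Qed.

Lemma derive_grad J x v : differentiable J x -> 'D_v J x = dot (grad J x) v.
Proof.
move=> dJ; rewrite derive_sum_delta//; apply: eq_bigr => j _.
by rewrite mxE mulrC.
Qed.

(** The inequality on the segment bounds the difference quotient of [J] at [y] along [x - y]; let
    the step tend to 0 from the right. The case [nu = 0] is plain convexity. *)
Lemma first_order J nu x y :
  (forall x y (t : R), 0 <= t <= 1 ->
    J (t *: x + (1 - t) *: y) <=
      t * J x + (1 - t) * J y - nu / 2 * t * (1 - t) * sqnorm (x - y)) ->
  differentiable J y ->
  J y + dot (grad J y) (x - y) + nu / 2 * sqnorm (x - y) <= J x.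
Proof.
move=> sJ dJ; rewrite -derive_grad//; set v := x - y.
have dv : derivable J y v by exact: diff_derivable.
have c1 : h^-1 *: (J (h *: v + y) - J y) @[h --> 0^'+] --> 'D_v J y.
  by apply: cvg_dnbhs_at_right; exact: dv.
have c2 : J x - J y - nu / 2 * (1 - h) * sqnorm v @[h --> 0^'+] -->
    J x - J y - nu / 2 * (1 - 0) * sqnorm v.
  apply: cvg_at_right_filter; apply: cvgB; first exact: cvg_cst.
  apply: cvgMr_tmp; apply: cvgMl_tmp.
  by apply: cvgB; [exact: cvg_cst|exact: cvg_id].
have : 'D_v J y <= J x - J y - nu / 2 * (1 - 0) * sqnorm v.
  apply: (ler_cvg_to c1 c2); near=> h.
  have h0 : 0 < h by near: h; exact: nbhs_right_gt.
  have h1 : h < 1 by near: h; apply: nbhs_right_lt.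
  have -> : h *: v + y = h *: x + (1 - h) *: y.
    by rewrite /v scalerBr scalerBl scale1r addrA addrAC.
  have := sJ x y h; rewrite (ltW h0) (ltW h1) => /(_ isT) H.
  rewrite /GRing.scale /= ler_pdivrMl//.
  by apply: le_trans (_ : _ <= h * J x + (1 - h) * J y - nu / 2 * h * (1 - h) * sqnorm v - J y) _; [rewrite lerB|lra].
by lra.
Unshelve. all: by end_near.
Qed.

(** Add [first_order] for [(x, y)] and for [(y, x)]: the values of [J] cancel. *)
Lemma grad_monotone J nu x y :
  (forall x y (t : R), 0 <= t <= 1 ->
    J (t *: x + (1 - t) *: y) <=
      t * J x + (1 - t) * J y - nu / 2 * t * (1 - t) * sqnorm (x - y)) ->
  (forall x, differentiable J x) ->
  nu * sqnorm (x - y) <= dot (x - y) (grad J x - grad J y).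
Proof.
move=> sJ dJ; have H1 := first_order x sJ (dJ y); have H2 := first_order y sJ (dJ x).
rewrite (sqnormB y x) -(opprB x y) dotNr in H2.
by rewrite dotDr dotNr ![dot (x - y) _]dotC; lra.
Qed.

Lemma convex_grad_monotone J x y : convex_fun J ->
  (forall x, differentiable J x) -> 0 <= dot (x - y) (grad J x - grad J y).
Proof.
move=> cJ dJ; rewrite -[leLHS](mul0r (sqnorm (x - y))).
apply: grad_monotone => // {x y} x y t t01.
by rewrite !mul0r subr0; exact: cJ.
Qed.

(** Mean value theorem for each coordinate of the gradient along the segment. The constant compares
    squared norms: one factor [M] comes from Cauchy-Schwarz, the other from summing the
    coordinates. *)
Lemma grad_lipschitz J : twice_diff_bounded_hessian J ->
  exists2 L, 0 <= L & forall x y, sqnorm (grad J x - grad J y) <= L * sqnorm (x - y).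
Proof.
move=> [_ [dg [lam Hlam]]].
have lam0 : 0 <= lam by apply: le_trans (Hlam 0); exact: normr_ge0.
exists (M%:R * (lam ^+ 2 * M%:R)); first by rewrite !mulr_ge0.
move=> x y; set v := x - y.
have dgj j z : differentiable (fun x => grad J x ord0 j) z.
  exact: (differentiable_comp (dg z) (differentiable_coord _ _ _)).
have der j z : `|'D_v (fun x => grad J x ord0 j) z| <= lam * \sum_i `|v ord0 i|.
  rewrite derive_sum_delta// (le_trans (ler_norm_sum _ _ _))// mulr_sumr.
  apply: ler_sum => i _; rewrite normrM mulrC ler_wpM2r//.
  apply: le_trans (Hlam z).
  have -> : 'D_(delta_mx ord0 i) (fun x => grad J x ord0 j) z = hess J z i j.
    by rewrite mxE derive_mx ?mxE//; exact: diff_derivable.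
  rewrite [leRHS]/Num.norm /= mx_normrE.
  exact: (le_bigmax _ (fun ij => `|hess J z ij.1 ij.2|) (i, j)).
(* Cauchy-Schwarz against the all-ones vector, by [|s| |t| <= s^2 / 2 + t^2 / 2] on each pair. *)
have sq1 : (\sum_i `|v ord0 i|) ^+ 2 <= M%:R * sqnorm v.
  rewrite expr2 mulr_suml; under eq_bigr do rewrite mulr_sumr.
  apply: (@le_trans _ _ (\sum_i \sum_j (v ord0 i ^+ 2 / 2 + v ord0 j ^+ 2 / 2))).
    apply: ler_sum => i _; apply: ler_sum => j _.
    rewrite -[v _ i ^+ 2]real_normK ?num_real// -[v _ j ^+ 2]real_normK ?num_real//.
    by have := sqr_ge0 (`|v ord0 i| - `|v ord0 j|); rewrite sqrrB; lra.
  under eq_bigr do rewrite big_split /= sumr_const card_ord.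
  rewrite big_split /= sumr_const card_ord sumrMnl -!mulr_suml -/(sqnorm v).
  by rewrite -mulr_natl; lra.
have coord j : (grad J x ord0 j - grad J y ord0 j) ^+ 2 <= lam ^+ 2 * (M%:R * sqnorm v).
  pose phi t := grad J (t *: v + y) ord0 j.
  have dphi t : is_derive t (1 : R) phi ('D_v (fun x => grad J x ord0 j) (t *: v + y)).
    (* The difference quotient of [phi] at [t] is the directional one at [t *: v + y], so no chain
       rule is called for. *)
    have E : (fun h : R => h^-1 *: (phi (h *: (1 : R) + t) - phi t)) =
      (fun h : R => h^-1 *: (grad J (h *: v + (t *: v + y)) ord0 j - grad J (t *: v + y) ord0 j)).
      apply/funext => h; rewrite /phi; congr (_ *: (grad J _ _ _ - _)).
      by rewrite addrA -scalerDl /GRing.scale /= mulr1.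
    apply: DeriveDef; last by rewrite /derive E.
    by rewrite /derivable E; exact: (diff_derivable (dgj j (t *: v + y))).
  have [|c _] := @MVT _ phi _ 0 1 ltr01 (fun t _ => dphi t).
    apply: continuous_subspaceT => t.
    by apply: differentiable_continuous; apply/derivable1_diffP; case: (dphi t).
  rewrite /phi scale1r scale0r add0r subr0 mulr1 /v subrK => ->.
  rewrite -real_normK ?num_real//; apply: le_trans (_ : (lam * \sum_i `|v ord0 i|) ^+ 2 <= _).
    by rewrite ler_sqr ?nnegrE ?der// mulr_ge0// sumr_ge0.
  by rewrite exprMn ler_wpM2l ?exprn_ge0.
rewrite {1}/sqnorm; apply: le_trans (_ : \sum_(j < M) lam ^+ 2 * (M%:R * sqnorm v) <= _).
  by apply: ler_sum => j _; rewrite !mxE; have := coord j; rewrite !mxE.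
by rewrite sumr_const card_ord -mulr_natl; lra.
Qed.
End Calculus.
(** * Potentials of the combination matrix *)

Section Uniform.
Variables (R : realType) (I : finType).

Lemma fin_common_bound (Q : I -> R -> Prop) :
  (forall i a b, a <= b -> Q i a -> Q i b) -> (forall i, exists2 a, 0 <= a & Q i a) ->
  exists2 a, 0 <= a & forall i, Q i a.
Proof.
move=> mQ eQ; have /choice[f fP] : forall i, exists a, 0 <= a /\ Q i a.
  by move=> i; have [a] := eQ i; exists a.
exists (\sum_i f i) => [|i]; first by apply: sumr_ge0 => i _; case: (fP i).
apply: mQ (fP i).2; rewrite (bigD1 i)//= lerDl.
by apply: sumr_ge0 => j _; case: (fP j).
Qed.

(** Inverses turn lower thresholds into upper bounds. *)
Lemma fin_common_pos (Q : I -> R -> Prop) :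
  (forall i a b, 0 < b <= a -> Q i a -> Q i b) -> (forall i, exists2 a, 0 < a & Q i a) ->
  exists2 a, 0 < a & forall i, Q i a.
Proof.
move=> mQ eQ.
have [i a b ab [a0 Qa]|i|b b0 bQ] := @fin_common_bound (fun i b => 0 < b /\ Q i b^-1).
- have b0 := lt_le_trans a0 ab; split => //; apply: mQ Qa.
  by rewrite invr_gt0 b0/= lef_pV2.
- by have [a a0 Qa] := eQ i; exists a^-1; rewrite ?invr_gt0 ?invrK// invr_ge0 ltW.
(* [b] may be 0 when [I] is empty; the added 1 keeps the witness positive. *)
exists (b + 1)^-1 => [|i]; first by rewrite invr_gt0; lra.
have [b1 Qb] := bQ i; apply: mQ Qb.
by rewrite invr_gt0 lef_pV2 ?posrE; lra.
Qed.

End Uniform.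

(** Take for [d y] the least [n] with [rch n y]; when it is positive, one step leads to a point that
    reaches the target in one step less. *)
Lemma hitting_time (X : Type) (step : X -> X -> Prop) (rch : nat -> X -> Prop) :
  (forall n y, rch n.+1 y -> exists x, step x y /\ rch n x) ->
  (forall y, exists n, rch n y) ->
  exists d : X -> nat, (forall y, d y = 0%N <-> rch 0%N y) /\
    (forall y, (0 < d y)%N -> exists x, step x y /\ (d x < d y)%N).
Proof.
move=> rS rE; have rb y : exists n, `[< rch n y >].
  by have [n] := rE y; exists n; apply/asboolP.
have dP y n : rch n y -> (ex_minn (rb y) <= n)%N.
  by move=> /asboolP ry; case: ex_minnP => m _; apply.
exists (fun y => ex_minn (rb y)); split => y.
  split=> [d0|/dP]; last by rewrite leqn0 => /eqP.
  by move: d0; case: ex_minnP => m /asboolP + _ m0; rewrite m0.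
case: ex_minnP => -[//|m] /asboolP /rS[x [xy rx]] _ _.
by exists x; split => //; rewrite ltnS; exact: dP.
Qed.

Section Potential.
Variables (R : realType) (X : finType) (Q : X -> X -> R) (d : X -> nat).

(* [u = 1 - e ^ d] works: [e ^ d] grows by a factor at least [1 / e] along one
   transition of probability at least [2 e]. *)
Lemma potential :
  (forall x y, 0 <= Q x y) -> (forall y, \sum_x Q x y = 1) ->
  (forall y, (0 < d y)%N -> exists x, 0 < Q x y /\ (d x < d y)%N) ->
  exists rho (u : X -> R), [/\ 0 <= rho < 1,
    forall x, d x = 0%N -> u x = 0,
    forall x, (0 < d x)%N -> 1 / 2 <= u x <= 1 &
    forall y, (0 < d y)%N -> \sum_x Q x y * u x <= rho * u y].
Proof.
move=> Q0 Q1 dQ.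
have [y a b /andP[_ ba] H /H [x [ax dx]]|y|a a0 aQ] := @fin_common_pos R X
    (fun y a => (0 < d y)%N -> exists x, a <= Q x y /\ (d x < d y)%N).
- by exists x; split => //; exact: le_trans ax.
- have [dy|dy] := posnP (d y); first by exists 1 => //; rewrite dy.
  by have [x [Qx dx]] := dQ y dy; exists (Q x y) => // _; exists x.
pose e := Num.min a 1 / 2.
have e0 : 0 < e by rewrite divr_gt0// lt_min a0 ltr01.
have e1 : e <= 1 / 2 by rewrite ler_wpM2r ?ge_min ?lexx ?orbT//; lra.
have ea : 2 * e <= a by rewrite /e mulrC divfK// ge_min lexx.
have e1' : e <= 1 by lra.
have ed n : 0 < e ^+ n by exact: exprn_gt0.
have ed1 n : e ^+ n <= 1 by apply: exprn_ile1 => //; exact: ltW.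
(* The sum of all [d x] exceeds each [d y], so its power of [e] is below every [e ^+ d y]: this
   makes [rho] uniform in [y]. *)
exists (1 - e ^+ (\sum_x d x)), (fun x => 1 - e ^+ d x); split.
- by rewrite subr_ge0 ed1 ltrBlDr ltrDl ed.
- by move=> x ->; rewrite expr0 subrr.
- move=> x; case: (d x) => // n _; have := ed1 n; have := ed n.+1.
  by rewrite exprS; nra.
- move=> y dy; have [x [ax dx]] := aQ y dy.
  rewrite /=; under eq_bigr do rewrite mulrBr mulr1.
  rewrite sumrB Q1 (bigD1 x)//=.
  have S0 : 0 <= \sum_(i | i != x) Q i y * e ^+ d i.
    by apply: sumr_ge0 => i _; rewrite mulr_ge0// ltW.
  have H1 : 2 * e ^+ d y <= Q x y * e ^+ d x.
    rewrite -(prednK dy) exprS mulrA ler_pM ?(ltW (ed _))//.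
    - by rewrite mulr_ge0// ltW.
    - exact: le_trans ax.
    - by apply: ler_wiXn2l => //; [exact: ltW|rewrite -ltnS prednK].
  have H2 : e ^+ (\sum_x d x) <= e ^+ d y.
    by apply: ler_wiXn2l => //; [exact: ltW|rewrite (bigD1 y)//= leq_addr].
  have := ed (d y); have := ed1 (d y); have := ed (\sum_x d x)%N; nra.
Qed.

End Potential.

Section Powers.
Variables (R : realType) (n : nat) (A : 'M[R]_n).
Hypothesis A0 : forall l k, 0 <= A l k.

Lemma expmxSr m l k : (A ^+ m.+1) l k = \sum_j (A ^+ m) l j * A j k.
Proof. by rewrite exprSr -mulmxE mxE. Qed.

Lemma expmx_ge0 m l k : 0 <= (A ^+ m) l k.
Proof.
elim: m l k => [|m IH] l k; first by rewrite expr0 mxE ler0n.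
by rewrite expmxSr sumr_ge0// => j _; rewrite mulr_ge0.
Qed.

Lemma expmxD_gt0 m m' l j k :
  0 < (A ^+ m) l j -> 0 < (A ^+ m') j k -> 0 < (A ^+ (m + m')) l k.
Proof.
move=> lj jk; rewrite exprD -mulmxE mxE (bigD1 j)//= ltr_pwDl ?mulr_gt0//.
by apply: sumr_ge0 => i _; rewrite mulr_ge0 ?expmx_ge0.
Qed.

Lemma expmxSr_gt0 m l k : 0 < (A ^+ m.+1) l k ->
  exists j, 0 < (A ^+ m) l j /\ 0 < A j k.
Proof.
rewrite expmxSr => H; have [j] : exists j, 0 < (A ^+ m) l j * A j k.
  apply: contrapT => nH; move: H; rewrite ltNge => /negP; apply.
  apply: sumr_le0 => j _; rewrite leNgt; apply/negP => Hj; apply: nH; by exists j.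
have := expmx_ge0 m l j; have := A0 j k.
rewrite !le_eqVlt => /orP[/eqP <-|jk]; rewrite ?mulr0 ?ltxx// => /orP[/eqP <-|lj].
  by rewrite mul0r ltxx.
by exists j.
Qed.

(** Carries the positivity given by primitivity and irreducibility of the blocks over to powers of
    [A] itself. *)
Lemma expmx_block (g : 'I_n -> nat) s m l k : (block_of g A s ^+ m) l k <= (A ^+ m) l k.
Proof.
have B0 i j : 0 <= block_of g A s i j by rewrite mxE; case: ifP.
have BA i j : block_of g A s i j <= A i j by rewrite mxE; case: ifP.
have BE p i j : 0 <= (block_of g A s ^+ p) i j.
  elim: p i j => [|p IH] i j; first by rewrite expr0 mxE ler0n.
  by rewrite exprSr -mulmxE mxE sumr_ge0// => a _; rewrite mulr_ge0.
elim: m l k => [|m IH] l k; first by rewrite !expr0.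
rewrite exprSr -mulmxE mxE expmxSr; apply: ler_sum => j _.
by rewrite ler_pM.
Qed.

End Powers.

(** * Limit points, and the weakly-connected network as a Markov chain *)

Section LimitPoint.
Variables (R : realType) (M NS NR : nat).
Variables (g : 'I_(NS + NR) -> nat) (A : 'M[R]_(NS + NR)) (wS : nat -> 'rV[R]_M).

Lemma diff_limit_point_lshift i :
  diff_limit_point g A wS (lshift NR i) = wS (g (lshift NR i)).
Proof. by rewrite /diff_limit_point (unsplitK (inl i)). Qed.

Lemma diff_limit_point_rshift j : diff_limit_point g A wS (rshift NS j) =
  \sum_(i < NS) Wmat A i j *: wS (g (lshift NR i)).
Proof. by rewrite /diff_limit_point (unsplitK (inr j)). Qed.

End LimitPoint.

Section Network.
Variables (R : realType) (M NS NR S Rn : nat).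
Variables (g : 'I_(NS + NR) -> nat) (A : 'M[R]_(NS + NR)).
Hypothesis hgS : forall i : 'I_NS, (g (lshift NR i) < S)%N.
Hypothesis hgR : forall j : 'I_NR, (S <= g (rshift NS j) < S + Rn)%N.
Hypothesis hA_nonneg : forall l k, 0 <= A l k.
Hypothesis hA_lstoch : forall k, \sum_(l < NS + NR) A l k = 1.
Hypothesis hA_dl : dlsubmx A = 0.
Hypothesis hA_SS : forall i j : 'I_NS,
  g (lshift NR i) <> g (lshift NR j) -> ulsubmx A i j = 0.
Hypothesis hA_RR : forall i j : 'I_NR,
  (g (rshift NS j) < g (rshift NS i))%N -> drsubmx A i j = 0.
Hypothesis hA_prim : forall s, (s < S)%N -> primitive_block g A s.
Hypothesis hA_irr : forall r, (S <= r < S + Rn)%N ->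
  irreducible_block g A r /\ receives_from_outside g A r.

(** Column [k] is read as the law of a jump from [k] to an agent that it listens to: started in
    group S, the chain never leaves its sub-network. *)
Lemma groupS_closed l k : (g k < S)%N -> A l k != 0 -> g l = g k.
Proof.
case: (split_ordP l) => i ->; case: (split_ordP k) => j -> gk.
- move=> /eqP Aij; apply: contrapT => /hA_SS; rewrite !mxE.
  exact: Aij.
- by move: gk; rewrite ltnNge; have /andP[-> _] := hgR j.
- have := congr1 (fun B : 'M[R]_(_, _) => B i j) hA_dl; rewrite !mxE => ->.
  by rewrite eqxx.
- by move: gk; rewrite ltnNge; have /andP[-> _] := hgR j.
Qed.

Lemma group_le l k : (S <= g k)%N -> A l k != 0 -> (g l <= g k)%N.
Proof.
case: (split_ordP k) => j -> gk; first by move: gk; rewrite leqNgt hgS.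
case: (split_ordP l) => i -> A0; first exact: leq_trans (ltnW (hgS i)) gk.
rewrite leqNgt; apply/negP => /hA_RR; rewrite !mxE.
exact/eqP.
Qed.

(** Induction on the label. Irreducibility leads from [k] to an agent [k'] of the same sub-network
    whose internal weights sum to less than 1; as its whole column sums to 1, [k'] listens to some
    [l] outside, and [group_le] makes the label of [l] smaller. *)
Lemma reach_groupS k : exists n, exists l, (g l < S)%N /\ 0 < (A ^+ n) l k.
Proof.
have [m] := ubnP (g k); elim: m k => // m IH k; rewrite ltnS => gm.
have [gk|gk] := ltnP (g k) S; first by exists 0%N, k; rewrite expr0 mxE eqxx.
have grk : (S <= g k < S + Rn)%N.
  by case: (split_ordP k) gk => j -> //; rewrite leqNgt hgS.
have [irr [k' [gk' out]]] := hA_irr grk.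
have [l [gl Al]] : exists l, g l != g k /\ 0 < A l k'.
  apply: contrapT => nE; move: out; rewrite -(hA_lstoch k') [ltRHS](bigID (fun l => g l == g k))/=.
  rewrite [X in _ < _ + X]big1 ?addr0 ?ltxx// => l gl.
  apply/eqP; rewrite eq_le hA_nonneg andbT leNgt; apply/negP => Al.
  by apply: nE; exists l.
have gl' : (g l < g k)%N.
  rewrite ltn_neqAle gl/= -gk'; apply: group_le; last by rewrite gt_eqF.
  by rewrite gk'.
have [n [l0 [gl0 P0]]] := IH l (leq_trans gl' gm).
have [n' P1] := irr k' k gk' erefl.
exists (n.+1 + n')%N, l0; split => //.
apply: (@expmxD_gt0 _ _ _ hA_nonneg _ _ _ k').
  by rewrite -addn1; apply: (@expmxD_gt0 _ _ _ hA_nonneg _ _ _ l) => //; rewrite expr1.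
exact: lt_le_trans P1 (expmx_block hA_nonneg _ _ _ _ _).
Qed.

(** The chain is [A] and the target is group S, which [reach_groupS] makes accessible from
    everywhere. *)
Lemma groupR_potential : exists rho (u : 'I_(NS + NR) -> R), [/\ 0 <= rho < 1,
    forall k, (g k < S)%N -> u k = 0,
    forall k, (S <= g k)%N -> 1 / 2 <= u k <= 1 &
    forall k, (S <= g k)%N -> \sum_l A l k * u l <= rho * u k].
Proof.
have [|d [d0 dS]] := @hitting_time _ (fun l k => 0 < A l k)
    (fun n k => exists l, (g l < S)%N /\ 0 < (A ^+ n) l k) _ reach_groupS.
  move=> n k [l [gl /(expmxSr_gt0 hA_nonneg)[j [lj jk]]]].
  by exists j; split => //; exists l.
have dE k : d k = 0%N <-> (g k < S)%N.
  apply: iff_trans (d0 k) _; split=> [[l []]|gk].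
    by rewrite expr0 mxE; case: eqP => [->//|_]; rewrite ltxx.
  by exists k; rewrite expr0 mxE eqxx.
have dgt k : (S <= g k)%N -> (0 < d k)%N.
  by move=> gk; rewrite lt0n; apply/eqP => /dE; rewrite ltnNge gk.
have [rho [u [rho01 u0 u1 uQ]]] := potential hA_nonneg hA_lstoch dS.
exists rho, u; split => // k gk; first exact/u0/dE.
- exact/u1/dgt.
- exact/uQ/dgt.
Qed.

(* The target is the diagonal: two independent copies of the chain meet, because
   a power of a primitive block is positive. *)
Lemma pair_potential : exists rho (u : 'I_(NS + NR) * 'I_(NS + NR) -> R),
  [/\ 0 <= rho < 1,
    forall kl, kl.1 = kl.2 \/ ~~ ((g kl.1 == g kl.2) && (g kl.1 < S)%N) -> u kl = 0,
    forall k l, k <> l -> g k = g l -> (g k < S)%N -> 1 / 2 <= u (k, l) <= 1 &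
    forall k l, k <> l -> g k = g l -> (g k < S)%N ->
      \sum_ab A ab.1 k * A ab.2 l * u ab <= rho * u (k, l)].
Proof.
pose good kl := (g kl.1 == g kl.2) && (g kl.1 < S)%N.
pose Q (ab kl : 'I_(NS + NR) * 'I_(NS + NR)) := A ab.1 kl.1 * A ab.2 kl.2.
(* Copies started at the two agents can meet at [j] after [n] steps. Pairs that are not inside one
   sub-network of group S are put in the target, so that every pair has a hitting time. *)
pose rch n (kl : 'I_(NS + NR) * 'I_(NS + NR)) := if good kl then
  exists j, 0 < (A ^+ n) j kl.1 /\ 0 < (A ^+ n) j kl.2 else n = 0%N.
have [||d [d0 dS]] := @hitting_time _ (fun ab kl => 0 < Q ab kl) rch.
- move=> n [k l]; rewrite /rch; case: ifPn => // /andP[/= /eqP gkl gk].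
  move=> [j [/(expmxSr_gt0 hA_nonneg)[a [ja ak]] /(expmxSr_gt0 hA_nonneg)[b [jb bl]]]].
  exists (a, b); split; first exact: mulr_gt0.
  have ga : g a = g k by apply: groupS_closed; rewrite ?gt_eqF.
  have gb : g b = g l by apply: groupS_closed; rewrite ?gt_eqF// -gkl.
  by rewrite /good /= ga gb gkl eqxx -gkl gk; exists j.
- move=> [k l]; case: (boolP (good (k, l))) => gd; last first.
    by exists 0%N; rewrite /rch (negbTE gd).
  have /andP[/= /eqP gkl gk] := gd.
  have [m pm] := hA_prim gk; exists m.+1; rewrite /rch gd; exists k; split.
    exact: lt_le_trans (pm k k erefl erefl) (expmx_block hA_nonneg _ _ _ _ _).
  exact: lt_le_trans (pm k l erefl (esym gkl)) (expmx_block hA_nonneg _ _ _ _ _).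
have dE kl : d kl = 0%N <-> kl.1 = kl.2 \/ ~~ good kl.
  apply: iff_trans (d0 kl) _; rewrite /rch; case: ifPn => gkl; last by split => // _; right.
  split=> [[j []]|[E|//]]; last by exists kl.1; rewrite -E expr0 mxE eqxx.
  rewrite expr0 !mxE; case: eqP => [->|_]; last by rewrite ltxx.
  by case: eqP => [->|_]; [left|rewrite ltxx].
have dgt k l : k <> l -> g k = g l -> (g k < S)%N -> (0 < d (k, l))%N.
  move=> kl gkl gk; rewrite lt0n; apply/eqP => /dE /= [//|].
  by rewrite /good /= gkl eqxx -gkl gk.
have Q1 kl : \sum_ab Q ab kl = 1.
  transitivity (\sum_a \sum_b A a kl.1 * A b kl.2); first by rewrite pair_bigA.
  by under eq_bigr do rewrite -mulr_sumr hA_lstoch mulr1.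
have Q0 ab kl : 0 <= Q ab kl by exact: mulr_ge0.
have [rho [u [rho01 u0 u1 uQ]]] := potential Q0 Q1 dS.
exists rho, u; split => //; first by move=> kl /dE /u0.
- by move=> k l kl gkl gk; apply/u1/dgt.
- by move=> k l kl gkl gk; apply/(uQ (k, l))/dgt.
Qed.

(** A maximum principle: if [v] is fixed by [drsubmx A], the largest ratio [r k] of [|v_k|] to the
    potential satisfies [r k <= rho * r k], hence vanishes. *)
Lemma subRR_unit : 1%:M - drsubmx A \in unitmx.
Proof.
have [rho [u [/andP[rho0 rho1] uS uR uA]]] := groupR_potential.
rewrite -row_free_unit -kermx_eq0 -submx0; apply/rV_subP => v /sub_kermxP.
rewrite mulmxBr mulmx1 => /eqP; rewrite subr_eq0 => /eqP vE.
rewrite submx0; apply/eqP.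
suff v0 j : `|v ord0 j| <= 0.
  by apply/rowP => j; rewrite mxE; apply/eqP; rewrite -normr_le0.
have ub k : 1 / 2 <= u (rshift NS k) <= 1 by apply: uR; case/andP: (hgR k).
have u0 k : 0 < u (rshift NS k) by have /andP[] := ub k; lra.
pose r k := `|v ord0 k| / u (rshift NS k).
have [k _ km] : exists2 k, true & forall l, r l <= r k.
  case: (@arg_maxP _ _ _ j xpredT r isT) => k _ km; exists k => // l; exact: km.
suff rk : r k <= 0.
  have := le_trans (km j) rk; rewrite /r ler_pdivrMr// mul0r; done.
have vk : `|v ord0 k| <= rho * (r k * u (rshift NS k)).
  rewrite {1}vE mxE; apply: le_trans (ler_norm_sum _ _ _) _.
  apply: (@le_trans _ _ (r k * \sum_l A l (rshift NS k) * u l)); last first.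
    rewrite mulrCA; apply: ler_wpM2l; first by rewrite divr_ge0// ltW.
    by apply: uA; case/andP: (hgR k).
  rewrite big_split_ord /= [X in _ * (X + _)]big1 ?add0r; last first.
    by move=> i _; rewrite uS ?mulr0.
  rewrite mulr_sumr; apply: ler_sum => l _.
  rewrite normrM !mxE mulrC (ger0_norm (hA_nonneg _ _)) mulrCA ler_wpM2l//.
  by rewrite -ler_pdivrMr// km.
have E : `|v ord0 k| = r k * u (rshift NS k) by rewrite /r divfK// gt_eqF.
rewrite E mulrA ler_pM2r// in vk.
rewrite leNgt; apply/negP => rk0; move: vk; rewrite leNgt => /negP; apply.
by rewrite gtr_pMl.
Qed.

(** In group S the limit point is constant on the support of column [k]; in group R this is the
    identity [W = T_SR + W T_RR]. It makes the errors in group R an average of errors. *)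
Lemma limit_point_harmonic (wS : nat -> 'rV[R]_M) k :
  diff_limit_point g A wS k = \sum_l A l k *: diff_limit_point g A wS l.
Proof.
have limS := diff_limit_point_lshift g A wS.
have limR := diff_limit_point_rshift g A wS.
case: (split_ordP k) => j ->.
  have E l : A l (lshift NR j) *: diff_limit_point g A wS l =
      A l (lshift NR j) *: wS (g (lshift NR j)).
    have [->|Al] := eqVneq (A l (lshift NR j)) 0; first by rewrite !scale0r.
    have := groupS_closed (hgS j) Al.
    case: (split_ordP l) => i -> gi; first by rewrite limS gi.
    by have := hgS j; rewrite -gi ltnNge; have /andP[-> _] := hgR i.
  by under eq_bigr do rewrite E; rewrite -scaler_suml hA_lstoch scale1r limS.
rewrite big_split_ord /= limR.
under [X in _ = X + _]eq_bigr do rewrite limS.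
under [X in _ = _ + X]eq_bigr do rewrite limR scaler_sumr.
rewrite [X in _ = _ + X]exchange_big /= -big_split; apply: eq_bigr => i _ /=.
under [X in _ = _ + X]eq_bigr do rewrite scalerA.
rewrite -scaler_suml -scalerDl; congr (_ *: _).
have : Wmat A *m (1%:M - drsubmx A) = ursubmx A by rewrite /Wmat mulmxKV// subRR_unit.
rewrite mulmxBr mulmx1 => /(congr1 (fun B : 'M[R]_(_, _) => B i j)).
rewrite !mxE => /eqP; rewrite subr_eq => /eqP ->; congr (_ + _).
by apply: eq_bigr => l _; rewrite !mxE mulrC.
Qed.

End Network.
(** * Bounds on second moments *)

Section SecondMoments.
Context d (T : measurableType d) (R : realType) (P : probability T R) (M : nat).
Implicit Types (f g : T -> R) (v w : T -> 'rV[R]_M).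

(** The space is a parameter because iterates must be measurable both for the ambient sigma-algebra
    and for the one generated by the past. *)
Definition rvec d' (T' : measurableType d') (w : T' -> 'rV[R]_M) :=
  forall j, measurable_fun setT (fun x => w x ord0 j).

(** Measurability and sign travel with the bound, so that bounds combine without side conditions on
    integrals. *)
Definition Ebnd f (c : R) := [/\ measurable_fun setT f, forall x, 0 <= f x &
  (\int[P]_x (f x)%:E <= c%:E)%E].

Lemma Ebnd_ge0 f c : Ebnd f c -> 0 <= c.
Proof.
move=> [_ f0 fc]; rewrite -lee_fin; apply: le_trans fc.
by apply: integral_ge0 => x _; rewrite lee_fin.
Qed.

Lemma Ebnd_le f g c e : measurable_fun setT f -> (forall x, 0 <= f x <= g x) ->
  Ebnd g c -> c <= e -> Ebnd f e.
Proof.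
move=> mf fg [mg _ gc] ce; split => //; first by move=> x; case/andP: (fg x).
apply: (@le_trans _ _ c%:E); last by rewrite lee_fin.
apply: le_trans gc; apply: ge0_le_integral => //.
- by move=> x _; rewrite lee_fin; case/andP: (fg x).
- exact/measurable_EFinP.
- exact/measurable_EFinP.
- by move=> x _; rewrite lee_fin; case/andP: (fg x).
Qed.

Lemma EbndW f c e : c <= e -> Ebnd f c -> Ebnd f e.
Proof.
move=> ce H; apply: (Ebnd_le _ _ H ce); case: H => // _ f0 _ x.
by rewrite f0 lexx.
Qed.

Lemma Ebnd_cst c : 0 <= c -> Ebnd (cst c) c.
Proof.
by move=> c0; split => //; rewrite -[leRHS]mule1 -(probability_setT P) -integral_cst.
Qed.

Lemma EbndD f g a b : Ebnd f a -> Ebnd g b -> Ebnd (fun x => f x + g x) (a + b).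
Proof.
move=> [mf f0 fa] [mg g0 gb]; split; first exact: measurable_funD.
  by move=> x; rewrite addr_ge0.
under eq_integral do rewrite EFinD.
rewrite ge0_integralD//; first by rewrite EFinD leeD.
- by move=> x _; rewrite lee_fin.
- exact/measurable_EFinP.
- by move=> x _; rewrite lee_fin.
- exact/measurable_EFinP.
Qed.

Lemma EbndZ f k a : 0 <= k -> Ebnd f a -> Ebnd (fun x => k * f x) (k * a).
Proof.
move=> k0 [mf f0 fa]; split; first exact: measurable_funM.
  by move=> x; rewrite mulr_ge0.
under eq_integral do rewrite EFinM.
rewrite ge0_integralZl_EFin//; first by rewrite EFinM lee_wpmul2l.
- by move=> x _; rewrite lee_fin.
- exact/measurable_EFinP.
Qed.

(** Bounds are asked only where the weight is nonzero, since disagreements are bounded only inside a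
    sub-network. *)
Lemma Ebnd_wsum (I : finType) (a : I -> R) (F : I -> T -> R) (c : I -> R) :
  (forall i, 0 <= a i) -> (forall i, a i != 0 -> Ebnd (F i) (c i)) ->
  Ebnd (fun x => \sum_i a i * F i x) (\sum_i a i * c i).
Proof.
move=> a0 H; elim: (index_enum I) => [|i s IH].
  rewrite big_nil (_ : (fun _ => _) = cst 0); first exact: Ebnd_cst.
  by apply/funext => x; rewrite big_nil.
rewrite big_cons (_ : (fun _ => _) =
    fun x => a i * F i x + \sum_(j <- s) a j * F j x); last first.
  by apply/funext => x; rewrite big_cons.
apply: EbndD => //; have [->|ai] := eqVneq (a i) 0; last exact/EbndZ/H.
rewrite mul0r (_ : (fun _ => _) = cst 0); first exact: Ebnd_cst.
by apply/funext => x; rewrite mul0r.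
Qed.

Lemma Ebnd_integrable f c : Ebnd f c -> P.-integrable setT (EFin \o f).
Proof.
move=> [mf f0 fc]; apply/integrableP; split; first exact/measurable_EFinP.
apply: le_lt_trans (ltry c).
apply: le_trans fc; apply: ge0_le_integral => //.
- by apply: measurableT_comp => //; exact/measurable_EFinP.
- exact/measurable_EFinP.
- by move=> x _; rewrite /= lee_fin ger0_norm.
Qed.

Lemma rvecD d' (T' : measurableType d') (v w : T' -> 'rV[R]_M) :
  rvec v -> rvec w -> rvec (fun x => v x + w x).
Proof.
move=> mv mw j; under eq_fun do rewrite mxE.
exact: measurable_funD.
Qed.

Lemma rvecZ d' (T' : measurableType d') a (v : T' -> 'rV[R]_M) :
  rvec v -> rvec (fun x => a *: v x).
Proof.
move=> mv j; under eq_fun do rewrite mxE.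
exact: measurable_funM.
Qed.

Lemma rvecB d' (T' : measurableType d') (v w : T' -> 'rV[R]_M) :
  rvec v -> rvec w -> rvec (fun x => v x - w x).
Proof.
move=> mv mw; under [X in rvec X]eq_fun do rewrite -scaleN1r.
by apply: rvecD => //; exact: rvecZ.
Qed.

Lemma rvec_cst d' (T' : measurableType d') (c : 'rV[R]_M) : rvec (cst c : T' -> _).
Proof. by move=> j; exact: measurable_cst. Qed.

Lemma rvec_sum d' (T' : measurableType d') (I : finType) (F : I -> T' -> 'rV[R]_M) :
  (forall i, rvec (F i)) -> rvec (fun x => \sum_i F i x).
Proof.
move=> mF j; under eq_fun do rewrite summxE.
by apply: measurable_sum => i; exact: mF.
Qed.

Lemma rvec_comp d' (T' : measurableType d') (f : 'rV[R]_M -> 'rV[R]_M) (v : T' -> 'rV[R]_M) :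
  continuous f -> rvec v -> rvec (fun x => f (v x)).
Proof.
move=> cf mv j.
apply: (@measurable_continuous_rV _ _ _ _ (fun z => f z ord0 j)) => //.
move=> z; apply: (@continuous_comp _ _ _ f (fun N : 'rV[R]_M => N ord0 j)).
  exact: cf.
exact: (@coord_continuous _ _ _ ord0 j (f z)).
Qed.

Lemma measurable_sqnorm v : rvec v -> measurable_fun setT (fun x => sqnorm (v x)).
Proof.
move=> mv; apply: measurable_sum => j.
exact: measurable_funX.
Qed.

Lemma Ebnd_sqnorm_le v g c e : rvec v -> (forall x, sqnorm (v x) <= g x) ->
  Ebnd g c -> c <= e -> Ebnd (fun x => sqnorm (v x)) e.
Proof.
move=> mv vg; apply: Ebnd_le; first exact: measurable_sqnorm.
by move=> x; rewrite sqnorm_ge0 vg.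
Qed.

(** Pythagoras: each [h_j n_j] is integrable, being dominated by the sum of the two squared norms,
    and integrates to 0 by [martingale_orth]. The bounds therefore add with constant 1. *)
Lemma Ebnd_orthogonal (G : set (set T)) (h n : T -> 'rV[R]_M) a b :
  (forall E, G E -> measurable E) ->
  @rvec _ (g_sigma_algebraType G) h -> rvec h ->
  (forall j, P.-integrable setT (fun x => (n x ord0 j)%:E)) ->
  (forall j E, <<s G >> E -> (\int[P]_(x in E) (n x ord0 j)%:E = 0)%E) ->
  Ebnd (fun x => sqnorm (h x)) a -> Ebnd (fun x => sqnorm (n x)) b ->
  Ebnd (fun x => sqnorm (h x + n x)) (a + b).
Proof.
move=> GT mGh mh in_ n0 ha nb.
have mn : rvec n by move=> j; have /integrableP[/measurable_EFinP] := in_ j.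
split; [exact/measurable_sqnorm/rvecD|by move=> x; exact: sqnorm_ge0|].
have hn := EbndD ha nb.
have ihn j : P.-integrable setT (fun x => (h x ord0 j * n x ord0 j)%:E).
  apply: le_integrable (Ebnd_integrable hn) => //.
    by apply/measurable_EFinP; exact: measurable_funM.
  move=> x _ /=; rewrite lee_fin [leRHS]ger0_norm ?addr_ge0 ?sqnorm_ge0//.
  have le_coord (v : 'rV[R]_M) : v ord0 j ^+ 2 <= sqnorm v.
    by rewrite /sqnorm (bigD1 j)//= lerDl sumr_ge0// => i _; exact: sqr_ge0.
  have := le_coord (h x); have := le_coord (n x).
  rewrite -[h x _ _ ^+ 2]real_normK ?num_real// -[n x _ _ ^+ 2]real_normK ?num_real//.
  rewrite normrM; have := normr_ge0 (h x ord0 j); have := normr_ge0 (n x ord0 j).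
  set p := `|h _ _ _|; set q := `|n _ _ _| => q0 p0 H1 H2.
  by have := sqr_ge0 (p - q); rewrite sqrrB; nra.
have -> : (\int[P]_x (sqnorm (h x + n x))%:E =
    \int[P]_x ((sqnorm (h x) + sqnorm (n x))%:E +
      \sum_(j < M) 2%:E * (h x ord0 j * n x ord0 j)%:E))%E.
  apply: eq_integral => x _; rewrite sqnormD /dot mulr_sumr.
  under [in RHS]eq_bigr do rewrite -EFinM.
  by rewrite sumEFin -EFinD; congr EFin; rewrite addrAC.
rewrite integralD//; last 2 first.
- exact: Ebnd_integrable hn.
- by apply: integrable_sum => // j _; exact: integrableZl.
rewrite integral_sum//; last by move=> j; exact: integrableZl.
rewrite big1 ?adde0; first by case: hn.
move=> j _; rewrite integralZl//.
by rewrite (@martingale_orth _ _ R P G (fun x => n x ord0 j) (fun x => h x ord0 j)) ?mule0//; [exact: in_|exact: n0].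
Qed.

Lemma integral_wsum0 (I : finType) (a : I -> R) (F : I -> T -> R) E :
  measurable E -> (forall i, P.-integrable setT (fun x => (F i x)%:E)) ->
  (forall i, (\int[P]_(x in E) (F i x)%:E = 0)%E) ->
  (\int[P]_(x in E) (\sum_i a i * F i x)%:E = 0)%E.
Proof.
move=> mE iF F0; have iFE i : P.-integrable E (fun x => (F i x)%:E).
  exact: integrableS (iF i).
under eq_integral do (rewrite -sumEFin; under eq_bigr do rewrite EFinM).
rewrite integral_sum//; last by move=> i; exact: integrableZl.
by rewrite big1// => i _; rewrite integralZl// F0 mule0.
Qed.

End SecondMoments.
(** * One step of the diffusion recursion *)

Section OneStep.
Variables (R : realType) (M N S : nat) (g : 'I_N -> nat) (A : 'M[R]_N).
Hypothesis A0 : forall l k, 0 <= A l k.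
Hypothesis A1 : forall k, \sum_l A l k = 1.
Hypothesis Acl : forall l k, (g k < S)%N -> A l k != 0 -> g l = g k.
Variable p : 'I_N -> R.
Hypothesis peig : forall s, (s < S)%N -> forall l, g l = s ->
  \sum_(k < N | g k == s) A l k * p k = p l.
Hypothesis psum : forall s, (s < S)%N -> \sum_(k < N | g k == s) p k = 1.
Hypothesis ppos : forall k, (g k < S)%N -> 0 < p k.
Variable tau : 'I_N -> R.
Hypothesis tau01 : forall k, 0 < tau k <= 1.
Variables (J : 'I_N -> 'rV[R]_M -> R) (L : R).
Hypothesis L0 : 0 <= L.
Hypothesis JL : forall k x y,
  sqnorm (grad (J k) x - grad (J k) y) <= L * sqnorm (x - y).
Hypothesis cJ : forall k, continuous (grad (J k)).
Variable a : R.
Hypothesis a0 : 0 < a.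
Hypothesis mono : forall s, (s < S)%N -> forall x y, a * sqnorm (x - y) <=
  \sum_(l < N | g l == s) tau l * p l * dot (x - y) (grad (J l) x - grad (J l) y).
Variables (wS : nat -> 'rV[R]_M) (wstar : 'I_N -> 'rV[R]_M).
Hypothesis wstar_S : forall k, (g k < S)%N -> wstar k = wS (g k).
Hypothesis harm : forall k, wstar k = \sum_l A l k *: wstar l.
Hypothesis wS_crit : forall s, (s < S)%N ->
  \sum_(l < N | g l == s) (tau l * p l) *: grad (J l) (wS s) = 0.
Variables (B beta sigma : R).
Hypothesis B_bound : forall k, sqnorm (grad (J k) (wstar k)) <= B.
Hypothesis B0 : 0 <= B.
Hypothesis beta0 : 0 <= beta.
Hypothesis sigma0 : 0 <= sigma.
Variables (rho1 rho2 : R) (u1 : 'I_N -> R) (u2 : 'I_N * 'I_N -> R).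
Hypothesis rho1_01 : 0 <= rho1 < 1.
Hypothesis u1_R : forall k, (S <= g k)%N -> 1 / 2 <= u1 k <= 1.
Hypothesis u1_S : forall k, (g k < S)%N -> u1 k = 0.
Hypothesis u1_contr : forall k, (S <= g k)%N -> \sum_l A l k * u1 l <= rho1 * u1 k.
Hypothesis rho2_01 : 0 <= rho2 < 1.
Hypothesis u2_diag : forall k, u2 (k, k) = 0.
Hypothesis u2_S : forall k l, k <> l -> g k = g l -> (g k < S)%N -> 1 / 2 <= u2 (k, l) <= 1.
Hypothesis u2_contr : forall k l, k <> l -> g k = g l -> (g k < S)%N ->
  \sum_ab A ab.1 k * A ab.2 l * u2 ab <= rho2 * u2 (k, l).

Definition pw s l : R := if g l == s then p l else 0.

Lemma pw_ge0 s l : (s < S)%N -> 0 <= pw s l.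
Proof. by rewrite /pw; case: eqP => // <- gl; exact/ltW/ppos. Qed.

Lemma pw_sum s : (s < S)%N -> \sum_l pw s l = 1.
Proof. by move=> sS; rewrite /pw -big_mkcond psum. Qed.

Lemma pw_group s l : pw s l != 0 -> g l = s.
Proof. by rewrite /pw; have [->|_] := eqVneq (g l) s; rewrite // eqxx. Qed.

(** Extended by zero, the Perron vector of a block is an eigenvector of the whole [A], because
    agents outside [s] send no weight into [s]. *)
Lemma pw_eig s l : (s < S)%N -> \sum_k A l k * pw s k = pw s l.
Proof.
move=> sS; rewrite [RHS]/pw; case: eqP => [gl|gl].
  rewrite -(peig sS gl) [RHS]big_mkcond; apply: eq_bigr => k _.
  by rewrite /pw; case: ifP; rewrite ?mulr0.
rewrite big1// => k _; rewrite /pw; case: eqP => [gk|]; rewrite ?mulr0//.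
have [->|/Acl] := eqVneq (A l k) 0; first by rewrite mul0r.
by rewrite gk => /(_ sS).
Qed.

Definition centroid s (v : 'I_N -> 'rV[R]_M) := \sum_l pw s l *: v l.

(* [t1] and [t2] are the slacks of the splittings |u + v|^2 <= (1 + t) |u|^2 + (1 + 1/t) |v|^2:
   they turn the contraction factors [rho] of the potentials into [(1 + rho) / 2]. *)
Definition Kg := 4 * L + 4 * B + 2 * beta + 2 * sigma.
Definition t1 := (1 - rho1) / 4.
Definition t2 := (1 - rho2) / 2.
(** The gains of the recursion: [KC] from disagreement to centroid error, [KN] for the noise in the
    centroid, [KD] for the adaptation step in the disagreements, [KY] for group S errors and
    adaptation in group R. *)
Definition KC := (1 + 2 / a) * L.
Definition KN := 2 * beta + sigma.
Definition KD := 16 * (1 + t2^-1) * Kg.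
Definition KY := 8 + 2 * (1 + t1^-1) * Kg.
Definition K := KC + KN + KD + KY.

Variable mu : R.
Hypothesis mu0 : 0 < mu.
Hypothesis mu1 : mu <= 1.
Hypothesis muL : mu * L <= a.
Hypothesis mua : a * mu <= 1.
Hypothesis muK : (1 + t1^-1) * mu ^+ 2 * Kg <= t1.

Context d (T : measurableType d) (P : probability T R).
Variables (w w' sn : 'I_N -> T -> 'rV[R]_M) (G : set (set T)).
Hypothesis GT : forall E, G E -> measurable E.
Hypothesis Gw : forall k, @rvec R M _ (g_sigma_algebraType G) (w k).
Hypothesis sn_int : forall k j, P.-integrable setT (fun x => (sn k x ord0 j)%:E).
Hypothesis sn0 : forall k j E, <<s G >> E -> (\int[P]_(x in E) (sn k x ord0 j)%:E = 0)%E.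
Hypothesis sn_mom : forall k m, Ebnd P (fun x => sqnorm (wstar k - w k x)) m ->
  Ebnd P (fun x => sqnorm (sn k x)) (beta * m + sigma).
Hypothesis w'E : forall k x, w' k x =
  \sum_l A l k *: (w l x - (tau l * mu) *: (grad (J l) (w l x) + sn l x)).

(* [C], [D] and [Y] bound the centroid errors and the disagreements in group S and
   the errors in group R; the last two are measured relative to the potentials. *)
Definition state (v : 'I_N -> T -> 'rV[R]_M) (C D Y : R) : Prop :=
  [/\ forall k, rvec (v k),
    forall s, (s < S)%N ->
      Ebnd P (fun x => sqnorm (centroid s (fun k => v k x) - wS s)) C,
    forall k l, g k = g l -> (g k < S)%N ->
      Ebnd P (fun x => sqnorm (v k x - v l x)) (D * u2 (k, l)) &
    forall k, (S <= g k)%N ->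
      Ebnd P (fun x => sqnorm (wstar k - v k x)) (Y * u1 k)].

(** The potentials are at least 1/2 off their absorbing sets, so doubling plain second-moment bounds
    gives bounds relative to them. *)
Lemma state_init (v : 'I_N -> T -> 'rV[R]_M) m : (forall k, rvec (v k)) ->
  0 <= m -> (forall k, Ebnd P (fun x => sqnorm (v k x)) m) ->
  exists C D Y, [/\ 0 <= C, 0 <= D, 0 <= Y & state v C D Y].
Proof.
move=> mv m0 hm.
have S0 : 0 <= \sum_(s < S) sqnorm (wS s) by apply: sumr_ge0 => s _; exact: sqnorm_ge0.
have W0 : 0 <= \sum_k sqnorm (wstar k) by apply: sumr_ge0 => k _; exact: sqnorm_ge0.
have le2 (x y : 'rV[R]_M) : sqnorm (x - y) <= 2 * sqnorm x + 2 * sqnorm y.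
  by rewrite -(sqnormN y); exact: sqnormD2_le.
exists (2 * m + 2 * \sum_(s < S) sqnorm (wS s)), (8 * m),
  (4 * m + 4 * \sum_k sqnorm (wstar k)).
split; [by rewrite addr_ge0// mulr_ge0|by rewrite mulr_ge0|by rewrite addr_ge0// mulr_ge0|].
split=> [//|s sS|k l gkl gk|k gk].
- have H1 : Ebnd P (fun x => \sum_l pw s l * sqnorm (v l x)) (\sum_l pw s l * m).
    by apply: Ebnd_wsum => l; [exact: pw_ge0|].
  have H := EbndD (EbndZ (ler0n R 2) H1)
    (EbndZ (ler0n R 2) (Ebnd_cst P (sqnorm_ge0 (wS s)))).
  apply: Ebnd_sqnorm_le H _.
  + apply: rvecB; last exact: rvec_cst.
    by apply: rvec_sum => l; exact: rvecZ.
  + move=> x; apply: le_trans (le2 _ _) _; rewrite lerD2r ler_wpM2l//.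
    by apply: sqnorm_sum_le => [l|]; rewrite ?pw_ge0 ?pw_sum.
  + rewrite -mulr_suml pw_sum// mul1r lerD2l ler_wpM2l//.
    by rewrite (bigD1 (Ordinal sS))//= lerDl; apply: sumr_ge0 => i _; exact: sqnorm_ge0.
- have [<-|/eqP kl] := eqVneq k l.
    rewrite u2_diag mulr0 (_ : (fun _ => _) = cst 0); first exact: Ebnd_cst.
    by apply/funext => x; rewrite subrr sqnorm0.
  have /andP[u12 _] := u2_S kl gkl gk.
  apply: Ebnd_sqnorm_le (EbndD (EbndZ (ler0n R 2) (hm k)) (EbndZ (ler0n R 2) (hm l))) _ => //.
    exact: rvecB.
  have : 8 * m * (1 / 2) <= 8 * m * u2 (k, l) by rewrite ler_wpM2l// mulr_ge0.
  by apply: le_trans; lra.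
- have /andP[u12 _] := u1_R gk.
  apply: Ebnd_sqnorm_le (EbndD (EbndZ (ler0n R 2) (Ebnd_cst P (sqnorm_ge0 (wstar k))))
    (EbndZ (ler0n R 2) (hm k))) _ => //.
    by apply: rvecB => //; exact: rvec_cst.
  set W := \sum__ _ in W0 *.
  have WW : sqnorm (wstar k) <= W.
    by rewrite /W (bigD1 k)//= lerDl; apply: sumr_ge0 => i _; exact: sqnorm_ge0.
  have : (4 * m + 4 * W) * (1 / 2) <= (4 * m + 4 * W) * u1 k.
    by rewrite ler_wpM2l// addr_ge0// mulr_ge0.
  by apply: le_trans; lra.
Qed.

Variables (C D Y : R).
Hypothesis C0 : 0 <= C.
Hypothesis D0 : 0 <= D.
Hypothesis Y0 : 0 <= Y.
Hypothesis st : state w C D Y.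

Let mw k : rvec (w k). Proof. by case: st. Qed.
Let msn k : rvec (sn k).
Proof. by move=> j; have /integrableP[/measurable_EFinP] := sn_int k j. Qed.

Lemma t1_gt0 : 0 < t1. Proof. by rewrite /t1; case/andP: rho1_01 => *; lra. Qed.
Lemma t2_gt0 : 0 < t2. Proof. by rewrite /t2; case/andP: rho2_01 => *; lra. Qed.

Lemma Kg_ge0 : 0 <= Kg.
Proof. by rewrite /Kg; move: L0 B0 beta0 sigma0 => *; lra. Qed.

Lemma gains_ge0 : [/\ 0 <= KC, 0 <= KN, 0 <= KD & 0 <= KY].
Proof.
have K0 := Kg_ge0; have t1p := t1_gt0; have t2p := t2_gt0.
split; first by rewrite mulr_ge0// addr_ge0// divr_ge0// ltW.
- by rewrite addr_ge0// mulr_ge0.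
- by rewrite !mulr_ge0// addr_ge0// invr_ge0 ltW.
- by rewrite addr_ge0// !mulr_ge0// addr_ge0// invr_ge0 ltW.
Qed.

Lemma K_ge0 : 0 <= K.
Proof. by have [h1 h2 h3 h4] := gains_ge0; exact: (addr_ge0 (addr_ge0 (addr_ge0 h1 h2) h3) h4). Qed.

Lemma u2_le1 k l : g k = g l -> (g k < S)%N -> u2 (k, l) <= 1.
Proof.
move=> gkl gk; have [->|/eqP kl] := eqVneq k l; first by rewrite u2_diag ler01.
by case/andP: (u2_S kl gkl gk).
Qed.

Lemma rvec_centroid d' (T' : measurableType d') s (v : 'I_N -> T' -> 'rV[R]_M) :
  (forall k, rvec (v k)) -> rvec (fun x => centroid s (fun k => v k x)).
Proof. by move=> mv; apply: rvec_sum => l; exact: rvecZ. Qed.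

(** The deviation from the centroid is a convex combination of disagreements, and [u2 <= 1]. *)
Lemma Ebnd_dispersion k : (g k < S)%N ->
  Ebnd P (fun x => sqnorm (centroid (g k) (fun l => w l x) - w k x)) D.
Proof.
move=> gk; have [_ _ hD _] := st.
have H : Ebnd P (fun x => \sum_l pw (g k) l * sqnorm (w l x - w k x))
    (\sum_l pw (g k) l * (D * u2 (l, k))).
  apply: Ebnd_wsum => l; first exact: pw_ge0.
  by move=> /pw_group gl; apply: hD; rewrite gl.
apply: Ebnd_sqnorm_le H _.
- by apply: rvecB => //; exact: rvec_centroid.
- move=> x; have -> : centroid (g k) (fun l => w l x) - w k x =
      \sum_l pw (g k) l *: (w l x - w k x).
    under [RHS]eq_bigr do rewrite scalerBr.
    by rewrite sumrB -scaler_suml pw_sum// scale1r.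
  apply: sqnorm_sum_le => [l|]; first exact: pw_ge0.
  by rewrite pw_sum.
- rewrite -[leRHS]mul1r -(pw_sum gk) mulr_suml; apply: ler_sum => l _.
  have [->|/pw_group gl] := eqVneq (pw (g k) l) 0; first by rewrite !mul0r.
  rewrite ler_wpM2l ?pw_ge0// -[leRHS]mulr1 ler_wpM2l//.
  by apply: u2_le1; rewrite gl.
Qed.

Lemma Ebnd_errS k : (g k < S)%N ->
  Ebnd P (fun x => sqnorm (wstar k - w k x)) (2 * (C + D)).
Proof.
move=> gk; have [_ hC _ _] := st.
have H := EbndD (EbndZ (ler0n R 2) (hC _ gk)) (EbndZ (ler0n R 2) (Ebnd_dispersion gk)).
apply: Ebnd_sqnorm_le H _.
- by apply: rvecB => //; exact: rvec_cst.
- move=> x; rewrite wstar_S// -(subrKA (centroid (g k) (fun l => w l x))).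
  by apply: le_trans (sqnormD2_le _ _) _; rewrite [X in 2 * X]sqnormB.
- by rewrite mulrDr.
Qed.

(** A single formula for both groups, as [u1] vanishes on group S; it can thus be averaged over a
    column of [A]. *)
Lemma Ebnd_err k : Ebnd P (fun x => sqnorm (wstar k - w k x)) (Y * u1 k + 2 * (C + D)).
Proof.
have [_ _ _ hY] := st; have [gk|gk] := ltnP (g k) S.
  by rewrite u1_S// mulr0 add0r; exact: Ebnd_errS.
by apply: EbndW (hY k gk); rewrite lerDl mulr_ge0// addr_ge0.
Qed.

Definition dir k x := grad (J k) (w k x) + sn k x.

Let mdir k : rvec (dir k).
Proof. by apply: rvecD => //; exact: rvec_comp. Qed.

(** Compare the gradient with its value at the limit point: the difference costs [L], the value
    itself [B], and the noise [beta] and [sigma]. *)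
Lemma Ebnd_dir k m : Ebnd P (fun x => sqnorm (wstar k - w k x)) m ->
  Ebnd P (fun x => sqnorm (dir k x)) (Kg * (m + 1)).
Proof.
move=> hm; have m0 := Ebnd_ge0 hm.
have H := EbndD (EbndD (EbndZ (mulr_ge0 (ler0n R 4) L0) hm) (Ebnd_cst P (mulr_ge0 (ler0n R 4) B0)))
  (EbndZ (ler0n R 2) (sn_mom hm)).
apply: Ebnd_sqnorm_le H _ => // [x|].
  apply: le_trans (sqnormD2_le _ _) _; rewrite lerD2r /cst.
  have := sqnormD2_le (grad (J k) (w k x) - grad (J k) (wstar k)) (grad (J k) (wstar k)).
  rewrite subrK; have := JL k (w k x) (wstar k); rewrite (sqnormB (w k x)).
  by have := B_bound k; lra.
rewrite /Kg; have := mulr_ge0 L0 m0; have := mulr_ge0 beta0 m0; have := mulr_ge0 sigma0 m0.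
by have := mulr_ge0 B0 m0; move: L0 beta0 => *; nra.
Qed.

Lemma Ebnd_dirS k : (g k < S)%N ->
  Ebnd P (fun x => sqnorm (dir k x)) (Kg * (2 * (C + D) + 1)).
Proof. by move=> gk; exact/Ebnd_dir/Ebnd_errS. Qed.

Definition adapt k x := w k x - (tau k * mu) *: dir k x.

Let madapt k : rvec (adapt k).
Proof. by apply: rvecB => //; exact: rvecZ. Qed.

Lemma rvec_next k : rvec (w' k).
Proof.
rewrite (_ : w' k = fun x => \sum_l A l k *: adapt l x); last by apply/funext => x; exact: w'E.
by apply: rvec_sum => l; exact: rvecZ.
Qed.

Lemma sqnorm_step k (v : 'rV[R]_M) : sqnorm ((tau k * mu) *: v) <= mu ^+ 2 * sqnorm v.
Proof.
rewrite sqnormZ ler_wpM2r ?sqnorm_ge0// exprMn ler_piMl ?sqr_ge0//.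
by case/andP: (tau01 k) => ? ?; rewrite exprn_ile1// ltW.
Qed.

Lemma nextE k x : w' k x = \sum_l A l k *: adapt l x.
Proof. exact: w'E. Qed.

(** The new difference averages the adapted differences over pairs with product weights, and
    [u2_contr] contracts the old disagreements. The whole adaptation step, noise included, is a
    perturbation of mean square O(mu^2). *)
Lemma pair_step k l : g k = g l -> (g k < S)%N ->
  Ebnd P (fun x => sqnorm (w' k x - w' l x))
    (((1 + rho2) / 2 * D + KD * mu ^+ 2 * (C + D + 1)) * u2 (k, l)).
Proof.
move=> gkl gk; have [<-|/eqP kl] := eqVneq k l.
  rewrite u2_diag mulr0 (_ : (fun _ => _) = cst 0); first exact: Ebnd_cst.
  by apply/funext => x; rewrite subrr sqnorm0.
have [_ _ hD _] := st; have t0 := t2_gt0.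
have t0' : 0 <= 1 + t2^-1 by rewrite addr_ge0// invr_ge0 ltW.
have K0 := Kg_ge0.
have mu2 := sqr_ge0 mu.
pose E0 := (1 + t2^-1) * (mu ^+ 2 * (4 * (Kg * (2 * (C + D) + 1)))).
have Hab (ab : 'I_N * 'I_N) : g ab.1 = g k -> g ab.2 = g k ->
    Ebnd P (fun x => sqnorm (adapt ab.1 x - adapt ab.2 x)) ((1 + t2) * (D * u2 ab) + E0).
  case: ab => [b c] /= gb gc.
  have ga x : (g x = g k) -> (g x < S)%N by move=> ->.
  have H := EbndD (EbndZ (addr_ge0 ler01 (ltW t0)) (hD b c (etrans gb (esym gc)) (ga _ gb)))
    (EbndZ t0' (EbndZ mu2 (EbndD (EbndZ (ler0n R 2) (Ebnd_dirS (ga _ gb)))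
       (EbndZ (ler0n R 2) (Ebnd_dirS (ga _ gc)))))).
  apply: Ebnd_sqnorm_le H _ => // [|x|]; first exact: rvecB.
    have -> : adapt b x - adapt c x = (w b x - w c x) +
        ((tau c * mu) *: dir c x - (tau b * mu) *: dir b x).
      by rewrite /adapt opprB [X in _ + X = _]addrC addrACA [X in _ + X = _]addrC.
    apply: le_trans (sqnormD_le _ _ t0) _; rewrite lerD2l ler_wpM2l//.
    apply: le_trans (sqnormD2_le _ _) _; rewrite sqnormN.
    by have := sqnorm_step b (dir b x); have := sqnorm_step c (dir c x); lra.
  by rewrite /E0 le_eqVlt; apply/orP; left; apply/eqP; ring.
have H : Ebnd P (fun x => \sum_ab (A ab.1 k * A ab.2 l) * sqnorm (adapt ab.1 x - adapt ab.2 x))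
    (\sum_ab (A ab.1 k * A ab.2 l) * ((1 + t2) * (D * u2 ab) + E0)).
  apply: Ebnd_wsum => ab; first exact: mulr_ge0.
  rewrite mulf_eq0 negb_or => /andP[Ak Al]; apply: Hab; first exact: Acl.
  by rewrite gkl; apply: Acl => //; rewrite -gkl.
have A2 : \sum_ab A ab.1 k * A ab.2 l = 1.
  transitivity (\sum_a \sum_b A a k * A b l); first by rewrite pair_bigA.
  by under eq_bigr do rewrite -mulr_sumr A1 mulr1.
apply: Ebnd_sqnorm_le H _ => [|x|]; first by apply: rvecB; exact: rvec_next.
  rewrite !nextE.
  have -> : \sum_j A j k *: adapt j x - \sum_j A j l *: adapt j x =
     \sum_ab (A ab.1 k * A ab.2 l) *: (adapt ab.1 x - adapt ab.2 x).
    rewrite -(pair_bigA _ (fun a b => (A a k * A b l) *: (adapt a x - adapt b x))) /=.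
    under [RHS]eq_bigr => i _.
      under eq_bigr do rewrite scalerBr.
      rewrite sumrB -scaler_suml -mulr_sumr A1 mulr1.
      over.
    rewrite /= sumrB; congr (_ - _); rewrite exchange_big /=; apply: eq_bigr => j _.
    by rewrite -scaler_suml -mulr_suml A1 mul1r.
  apply: sqnorm_sum_le; last by rewrite A2.
  by move=> ab; exact: mulr_ge0.
under eq_bigr do rewrite mulrDr.
rewrite big_split /= -mulr_suml A2 mul1r.
have -> : \sum_ab A ab.1 k * A ab.2 l * ((1 + t2) * (D * u2 ab)) =
    (1 + t2) * D * \sum_ab A ab.1 k * A ab.2 l * u2 ab.
  by rewrite mulr_sumr; apply: eq_bigr => ab _; ring.
have [u12 _] := andP (u2_S kl gkl gk).
have u0 : 0 <= u2 (k, l) by lra.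
rewrite [leRHS]mulrDl; apply: lerD.
  apply: (@le_trans _ _ ((1 + t2) * D * (rho2 * u2 (k, l)))).
    by rewrite ler_wpM2l ?u2_contr// mulr_ge0// addr_ge0// ltW.
  have -> : (1 + t2) * D * (rho2 * u2 (k, l)) = (1 + t2) * rho2 * (D * u2 (k, l)) by ring.
  rewrite -[leRHS]mulrA ler_wpM2r ?mulr_ge0//.
  by rewrite /t2; move: rho2_01 => /andP[r0 r1]; nra.
rewrite /E0 /KD.
have -> : 16 * (1 + t2^-1) * Kg * mu ^+ 2 * (C + D + 1) * u2 (k, l) =
  ((1 + t2^-1) * mu ^+ 2 * Kg) * (16 * (C + D + 1) * u2 (k, l)) by ring.
have -> : (1 + t2^-1) * (mu ^+ 2 * (4 * (Kg * (2 * (C + D) + 1)))) =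
  ((1 + t2^-1) * mu ^+ 2 * Kg) * (4 * (2 * (C + D) + 1)) by ring.
have Z0 : 0 <= (1 + t2^-1) * mu ^+ 2 * Kg by apply: mulr_ge0 => //; exact: mulr_ge0.
rewrite ler_wpM2l//.
(* Off the diagonal [u2 >= 1/2], so a term without potential is absorbed at the cost of a factor
   2. *)
have : (16 * (C + D + 1)) * (1 / 2) <= 16 * (C + D + 1) * u2 (k, l).
  by rewrite ler_wpM2l// mulr_ge0// !addr_ge0.
by apply: le_trans; lra.
Qed.

(** By [harm], the new error averages the adapted errors of all agents; [u1_contr] contracts the
    part from group R, while group S enters as an input through [C + D]. *)
Lemma groupR_step k : (S <= g k)%N ->
  Ebnd P (fun x => sqnorm (wstar k - w' k x))
    (((1 + rho1) / 2 * Y + KY * (C + D + mu ^+ 2)) * u1 k).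
Proof.
move=> gk; have t0 := t1_gt0.
have t0' : 0 <= 1 + t1^-1 by rewrite addr_ge0// invr_ge0 ltW.
have mu2 := sqr_ge0 mu.
pose m l := Y * u1 l + 2 * (C + D).
pose E0 := (1 + t1^-1) * mu ^+ 2 * Kg.
have Hl l : Ebnd P (fun x => sqnorm (wstar l - adapt l x)) ((1 + 2 * t1) * m l + E0).
  have hm := Ebnd_err l; have m0 := Ebnd_ge0 hm.
  have H := EbndD (EbndZ (addr_ge0 ler01 (ltW t0)) hm) (EbndZ t0' (EbndZ mu2 (Ebnd_dir hm))).
  apply: Ebnd_sqnorm_le H _ => [|x|].
  - by apply: rvecB => //; exact: rvec_cst.
  - have -> : wstar l - adapt l x = (wstar l - w l x) + (tau l * mu) *: dir l x.
      by rewrite /adapt opprB addrCA addrC.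
    apply: le_trans (sqnormD_le _ _ t0) _; rewrite lerD2l ler_wpM2l//.
    exact: sqnorm_step.
  (* The slack is spent twice, in the splitting and, through [muK], on the growth of the step with
     [m l]; hence the 4 in [t1] against the 2 in [t2]. *)
  - rewrite -/(m l) in m0 *; rewrite [mu ^+ 2 * _]mulrA mulrA [_ * (mu ^+ 2 * _)]mulrA -/E0.
    have := ler_wpM2r m0 muK; rewrite -/E0; lra.
have H : Ebnd P (fun x => \sum_l A l k * sqnorm (wstar l - adapt l x))
    (\sum_l A l k * ((1 + 2 * t1) * m l + E0)).
  by apply: Ebnd_wsum => l // _; exact: Hl.
apply: Ebnd_sqnorm_le H _ => [|x|].
- by apply: rvecB; [exact: rvec_cst|exact: rvec_next].
- rewrite harm nextE -sumrB; under eq_bigr do rewrite -scalerBr.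
  by apply: sqnorm_sum_le => //; rewrite A1.
have -> : \sum_l A l k * ((1 + 2 * t1) * m l + E0) =
    (1 + 2 * t1) * Y * (\sum_l A l k * u1 l) + ((1 + 2 * t1) * (2 * (C + D)) + E0).
  transitivity (\sum_l ((1 + 2 * t1) * Y * (A l k * u1 l) +
      A l k * ((1 + 2 * t1) * (2 * (C + D)) + E0))).
    by apply: eq_bigr => l _; rewrite /m; ring.
  by rewrite big_split /= -mulr_sumr -mulr_suml A1 mul1r.
have [u12 _] := andP (u1_R gk).
have u0 : 0 <= u1 k by lra.
have /andP[r0 r1] := rho1_01.
rewrite [leRHS]mulrDl; apply: lerD.
  apply: (@le_trans _ _ ((1 + 2 * t1) * Y * (rho1 * u1 k))).
    by rewrite ler_wpM2l ?u1_contr// !mulr_ge0// addr_ge0// mulr_ge0// ltW.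
  have -> : (1 + 2 * t1) * Y * (rho1 * u1 k) = (1 + 2 * t1) * rho1 * (Y * u1 k) by ring.
  rewrite -[leRHS]mulrA ler_wpM2r ?mulr_ge0//.
  by rewrite /t1; nra.
have CD0 : 0 <= C + D by exact: addr_ge0.
have K0 := Kg_ge0.
have E00 : 0 <= E0 by apply: mulr_ge0 => //; exact: mulr_ge0.
have EK : KY * (C + D + mu ^+ 2) * (1 / 2) <= KY * (C + D + mu ^+ 2) * u1 k.
  have KY0 : 0 <= KY by rewrite /KY addr_ge0// !mulr_ge0.
  by rewrite ler_wpM2l// mulr_ge0// addr_ge0.
apply: le_trans EK.
have tt : 1 + 2 * t1 <= 3 / 2 by rewrite /t1; lra.
have H2 : (1 + 2 * t1) * (2 * (C + D)) <= 3 / 2 * (2 * (C + D)) by rewrite ler_wpM2r// mulr_ge0.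
have H3 : 0 <= (1 + t1^-1) * Kg * (C + D) by rewrite !mulr_ge0.
rewrite /KY; rewrite /E0 in E00 *; have := E00; set z := t1^-1 in H3 *; nra.
Qed.

(** Combination preserves the centroid, by [pw_eig]; only adaptation moves it. *)
Lemma centroid_next s x : (s < S)%N ->
  centroid s (fun k => w' k x) = \sum_l pw s l *: adapt l x.
Proof.
move=> sS; rewrite /centroid; under eq_bigr do rewrite nextE scaler_sumr.
rewrite exchange_big /=; apply: eq_bigr => l _.
rewrite -[in RHS](pw_eig l sS) scaler_suml; apply: eq_bigr => k _.
by rewrite scalerA mulrC.
Qed.

(** A gradient step taken at the centroid contracts by [1 - a * mu]; evaluating gradients at the
    agents instead costs disagreement, and the noise is orthogonal to both. *)
Lemma centroid_step s : (s < S)%N ->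
  Ebnd P (fun x => sqnorm (centroid s (fun k => w' k x) - wS s))
    ((1 - a * mu / 2) * C + KC * mu * D + KN * mu ^+ 2 * (C + D + 1)).
Proof.
move=> sS; have [_ hC _ _] := st.
pose q l := pw s l * tau l.
have q0 l : 0 <= q l by rewrite mulr_ge0 ?pw_ge0//; case/andP: (tau01 l) => /ltW.
have q1 : \sum_l q l <= 1.
  rewrite -(pw_sum sS); apply: ler_sum => l _; rewrite ler_piMr ?pw_ge0//.
  by case/andP: (tau01 l).
have qg l : q l != 0 -> g l = s by rewrite mulf_eq0 negb_or => /andP[/pw_group].
pose c x := centroid s (fun k => w k x).
pose X x := c x - wS s.
pose D1 x := \sum_l q l *: (grad (J l) (c x) - grad (J l) (wS s)).
pose D2 x := \sum_l q l *: (grad (J l) (w l x) - grad (J l) (c x)).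
(* [h] depends on the past only and [n] is centred noise; [D2] corrects for gradients taken at
   [w l x] rather than at the centroid. *)
pose h x := (X x - mu *: D1 x) + (- mu) *: D2 x.
pose n x := \sum_l q l *: ((- mu) *: sn l x).
have crit : \sum_l q l *: grad (J l) (wS s) = 0.
  rewrite -[RHS](wS_crit sS) [RHS]big_mkcond; apply: eq_bigr => l _.
  by rewrite /q /pw; case: eqP; rewrite ?mul0r ?scale0r// mulrC.
have split_next x : centroid s (fun k => w' k x) - wS s = h x + n x.
  have D12 : D1 x + D2 x = \sum_l q l *: grad (J l) (w l x).
    rewrite /D1 /D2 -big_split /= -[RHS]subr0 -[X in _ - X]crit -sumrB.
    by apply: eq_bigr => l _; rewrite -scalerDr -scalerBr addrC subrKA.
  have nE : n x = (- mu) *: \sum_l q l *: sn l x.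
    by rewrite scaler_sumr; apply: eq_bigr => l _; rewrite !scalerA mulrC.
  have -> : h x + n x = X x + (- mu) *: \sum_l q l *: dir l x.
    have -> : \sum_l q l *: dir l x = D1 x + D2 x + \sum_l q l *: sn l x.
      by rewrite D12 -big_split; apply: eq_bigr => l _; rewrite /dir scalerDr.
    by rewrite /h nE -scaleNr !scalerDr !addrA.
  rewrite centroid_next// /X -addrAC; congr (_ - _).
  rewrite /c /centroid scaler_sumr -big_split; apply: eq_bigr => l _ /=.
  by rewrite /adapt scalerBr !scalerA -scaleNr; congr (_ + _ *: _); rewrite /q; ring.
(* Stated for any space, to be used with the ambient sigma-algebra and with the past. *)
have hc d' (T' : measurableType d') (v : 'I_N -> T' -> 'rV[R]_M) : (forall k, rvec (v k)) ->
    rvec (fun x => (centroid s (fun k => v k x) - wS s - mu *: (\sum_l q l *: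
     (grad (J l) (centroid s (fun k => v k x)) - grad (J l) (wS s)))) +
     (- mu) *: \sum_l q l *: (grad (J l) (v l x) - grad (J l) (centroid s (fun k => v k x)))).
  move=> mv; have mc := rvec_centroid s mv.
  apply: rvecD; first apply: rvecB; first by apply: rvecB => //; exact: rvec_cst.
    apply: rvecZ; apply: rvec_sum => l; apply: rvecZ; apply: rvecB; last exact: rvec_cst.
    exact: rvec_comp.
  apply: rvecZ; apply: rvec_sum => l; apply: rvecZ; apply: rvecB; exact: rvec_comp.
have Gh : @rvec R M _ (g_sigma_algebraType G) h by exact: hc.
have mh : rvec h by exact: hc.
have hX := hC s sS.
have hdisp l : q l != 0 -> Ebnd P (fun x => sqnorm (w l x - c x)) D.
  move=> /qg gl; have := @Ebnd_dispersion l; rewrite gl => /(_ sS).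
  rewrite (_ : (fun _ => _) = fun x => sqnorm (w l x - c x)) => [//|].
  by apply/funext => x; rewrite sqnormB.
have amu0 : 0 < a * mu by exact: mulr_gt0.
have Eh : Ebnd P (fun x => sqnorm (h x)) ((1 - a * mu / 2) * C + KC * mu * D).
  have H := EbndD (EbndZ (_ : 0 <= 1 - a * mu / 2) hX)
    (EbndZ (_ : 0 <= KC * mu) (Ebnd_wsum q0 hdisp)).
  apply: Ebnd_sqnorm_le (H _ _) _ => //.
  (* This splitting leaves half of the contraction, [(1 + t) * (1 - a * mu) <= 1 - a * mu / 2], and
     makes [(1 + 1 / t) * mu^2] of order [mu]. *)
  - move=> x; pose t := a * mu / 2.
    have t0 : 0 < t by rewrite /t; lra.
    have t0' : 0 <= 1 + t^-1 by rewrite addr_ge0// invr_ge0 ltW.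
    have S1 : sqnorm (X x - mu *: D1 x) <= (1 - a * mu) * sqnorm (X x).
      rewrite sqnormD sqnormN sqnormZ dotNr dotZr.
      have dX : a * sqnorm (X x) <= dot (X x) (D1 x).
        apply: le_trans (mono sS (c x) (wS s)) _.
        rewrite dot_sumr big_mkcond; apply: ler_sum => l _; rewrite dotZr /q /pw.
        by case: eqP => _; rewrite ?mul0r// [tau l * _]mulrC.
      have sD : sqnorm (D1 x) <= L * sqnorm (X x).
        apply: le_trans (sqnorm_sum_le _ q0 q1) _.
        apply: (@le_trans _ _ (\sum_l q l * (L * sqnorm (X x)))).
          by apply: ler_sum => l _; rewrite ler_wpM2l.
        by rewrite -mulr_suml ler_piMl// mulr_ge0// sqnorm_ge0.
      have e1 := ler_wpM2l (ltW mu0) dX.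
      have e2 := ler_wpM2l (sqr_ge0 mu) sD.
      (* By [muL] the second-order term eats at most half of the first-order decrease
         [2 * a * mu]. *)
      have e3 : mu ^+ 2 * (L * sqnorm (X x)) <= mu * (a * sqnorm (X x)).
        rewrite expr2 -mulrA ler_wpM2l ?(ltW mu0)// mulrA.
        by rewrite ler_wpM2r ?sqnorm_ge0.
      have := le_trans e2 e3; move: e1; lra.
    have S2 : sqnorm ((- mu) *: D2 x) <= mu ^+ 2 * (L * \sum_l q l * sqnorm (w l x - c x)).
      rewrite sqnormZ sqrrN ler_wpM2l ?sqr_ge0//.
      apply: le_trans (sqnorm_sum_le _ q0 q1) _; rewrite mulr_sumr.
      by apply: ler_sum => l _; rewrite mulrCA ler_wpM2l.
    apply: le_trans (sqnormD_le _ _ t0) _; apply: lerD.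
      apply: (@le_trans _ _ ((1 + t) * ((1 - a * mu) * sqnorm (X x)))).
        by rewrite ler_wpM2l// addr_ge0// ltW.
      by rewrite mulrA ler_wpM2r ?sqnorm_ge0// /t; nra.
    apply: le_trans (ler_wpM2l t0' S2) _; rewrite !mulrA ler_wpM2r//.
      by apply: sumr_ge0 => l _; rewrite mulr_ge0 ?sqnorm_ge0.
    rewrite /KC [leRHS]mulrAC ler_wpM2r// /t.
    have -> : (1 + (a * mu / 2)^-1) * mu * mu = mu * mu + 2 / a * mu.
      by field; rewrite !gt_eqF.
    by rewrite [leRHS]mulrDl mul1r lerD2r ler_piMl// ltW.
  - by move: mua amu0; set z := a * mu => *; lra.
  - by rewrite !mulr_ge0 ?(ltW mu0)// addr_ge0// divr_ge0// ltW.
  - have Kp : 0 <= KC * mu.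
      by rewrite !mulr_ge0 ?(ltW mu0)// addr_ge0// divr_ge0// ltW.
    by rewrite lerD2l -mulr_suml ler_wpM2l// ler_piMl.
have En : Ebnd P (fun x => sqnorm (n x)) (KN * mu ^+ 2 * (C + D + 1)).
  have hsn l : q l != 0 -> Ebnd P (fun x => mu ^+ 2 * sqnorm (sn l x))
      (mu ^+ 2 * (beta * (2 * (C + D)) + sigma)).
    move=> /qg gl; apply: EbndZ; first exact: sqr_ge0.
    by apply: sn_mom; apply: Ebnd_errS; rewrite gl.
  apply: Ebnd_sqnorm_le (Ebnd_wsum q0 hsn) _ => [|x|].
  - by apply: rvec_sum => l; apply: rvecZ; exact: rvecZ.
  - apply: le_trans (sqnorm_sum_le _ q0 q1) _.
    by apply: ler_sum => l _; rewrite sqnormZ sqrrN.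
  - have CD0 : 0 <= C + D by exact: addr_ge0.
    rewrite -mulr_suml; set m := mu ^+ 2 * _.
    have m0 : 0 <= m by rewrite mulr_ge0 ?sqr_ge0// addr_ge0// mulr_ge0// mulr_ge0.
    apply: (@le_trans _ _ m); first by rewrite ler_piMl.
    have -> : KN * mu ^+ 2 * (C + D + 1) = mu ^+ 2 * (KN * (C + D + 1)) by ring.
    rewrite /m ler_wpM2l ?sqr_ge0// /KN.
    have := mulr_ge0 sigma0 CD0; move: beta0; nra.
have -> : (fun x => sqnorm (centroid s (fun k => w' k x) - wS s)) = fun x => sqnorm (h x + n x).
  by apply/funext => x; rewrite split_next.
have nE j x : n x ord0 j = \sum_l (- mu * q l) * sn l x ord0 j.
  by rewrite /n summxE; apply: eq_bigr => l _; rewrite !mxE; ring.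
apply: (Ebnd_orthogonal GT Gh mh _ _ Eh En).
- move=> j; rewrite (_ : (fun _ => _) =
      fun x => (\sum_l (- mu * q l)%:E * (sn l x ord0 j)%:E)%E).
    by apply: integrable_sum => // l _; exact: integrableZl.
  by apply/funext => x; rewrite nE -sumEFin; under eq_bigr do rewrite EFinM.
- move=> j E GE; under eq_integral do rewrite nE.
  apply: integral_wsum0 => //; last by move=> l; exact: sn0.
  by move: GE => /(_ measurable); apply; split => //; exact: sigma_algebra_measurable.
Qed.

Lemma state_next : state w'
  ((1 - a * mu / 2) * C + K * mu * D + K * mu ^+ 2 * (C + D + 1))
  ((1 + rho2) / 2 * D + K * mu ^+ 2 * (C + D + 1))
  ((1 + rho1) / 2 * Y + K * (C + D + mu ^+ 2)).
Proof.
have [KC0 KN0 KD0 KY0] := gains_ge0.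
have CD0 : 0 <= C + D by exact: addr_ge0.
have [KCK KNK KDK KYK] : [/\ KC <= K, KN <= K, KD <= K & KY <= K].
  by rewrite /K; split; lra.
have mu2 := sqr_ge0 mu.
split=> [k|s sS|k l gkl gk|k gk]; first exact: rvec_next.
- apply: EbndW (centroid_step sS); apply: lerD; first rewrite lerD2l.
    by rewrite ler_wpM2r// ler_wpM2r// ltW.
  by rewrite ler_wpM2r ?addr_ge0// ler_wpM2r.
- apply: EbndW (pair_step gkl gk).
  have [->|/eqP kl] := eqVneq k l; first by rewrite u2_diag !mulr0.
  have /andP[u12 _] := u2_S kl gkl gk.
  rewrite ler_wpM2r//; first by apply: le_trans u12; lra.
  by rewrite lerD2l ler_wpM2r ?addr_ge0// ler_wpM2r.
- apply: EbndW (groupR_step gk).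
  have /andP[u12 _] := u1_R gk.
  rewrite ler_wpM2r//; first by apply: le_trans u12; lra.
  by rewrite lerD2l ler_wpM2r// addr_ge0.
Qed.




End OneStep.
(** * The scalar recursion *)

Section Recursions.
Variable R : realType.

(** The excess over the fixed point [b / (1 - r)] is at most geometric; [e] absorbs it
    eventually. *)
Lemma affine_eventually (r b e : R) (x : nat -> R) n0 :
  0 <= r < 1 -> 0 < e -> (forall n, (n0 <= n)%N -> x n.+1 <= r * x n + b) ->
  exists n1, forall n, (n1 <= n)%N -> x n <= b / (1 - r) + e.
Proof.
move=> /andP[r0 r1] e0 xS; pose z := x n0 - b / (1 - r).
have r1' : 1 - r != 0 by rewrite subr_eq0 eq_sym lt_eqF.
have H n : x (n0 + n)%N <= b / (1 - r) + r ^+ n * z.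
  elim: n => [|n IH]; first by rewrite addn0 expr0 mul1r /z addrC subrK.
  rewrite addnS; apply: le_trans (xS _ (leq_addr _ _)) _.
  have := ler_wpM2l r0 IH; rewrite exprS mulrDr.
  have -> : r * (b / (1 - r)) = b / (1 - r) - b by field.
  by rewrite mulrA; lra.
have : (fun n => r ^+ n * `|z|) @ \oo --> 0 * `|z|.
  by apply: cvgMl; apply: cvg_expr; rewrite ger0_norm.
rewrite mul0r => /cvgrPdist_le /(_ e e0) [n1 _ n1P].
exists (n0 + n1)%N => n nn; have n0n : (n0 <= n)%N by apply: leq_trans nn; exact: leq_addr.
rewrite -(subnKC n0n); apply: le_trans (H _) _; rewrite lerD2l.
have := n1P (n - n0)%N; rewrite /= leq_subRL// => /(_ nn).
rewrite sub0r normrN normrM normr_id ger0_norm ?exprn_ge0//.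
by apply: le_trans; rewrite ler_wpM2l ?exprn_ge0// ler_norm.
Qed.

Lemma limn_esup_le_eventually (u : (\bar R)^nat) (c : \bar R) n0 :
  (forall n, (n0 <= n)%N -> (u n <= c)%E) -> (limn_esup u <= c)%E.
Proof.
move=> uc; rewrite limn_esup_lim; apply: lime_le; first exact: is_cvg_esups.
exists n0 => // n /= n0n; apply: ge_ereal_sup => _ [m /= nm <-].
by apply: uc; exact: leq_trans nm.
Qed.

(** For small [mu], the sum [C + D] alone obeys an affine recursion with factor [1 - a * mu / 4] and
    input O(mu^2), hence is eventually O(mu); it then drives [Y], whose factor does not depend on
    [mu]. *)
Lemma coupled_recursion (a K rho1 rho2 : R) : 0 < a -> 0 <= K ->
  0 <= rho1 < 1 -> 0 <= rho2 < 1 ->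
  exists mubar c, [/\ 0 < mubar, 0 <= c & forall mu, 0 < mu < mubar ->
  forall C D Y : nat -> R, (forall n, 0 <= C n) -> (forall n, 0 <= D n) ->
  (forall n, C n.+1 = (1 - a * mu / 2) * C n + K * mu * D n + K * mu ^+ 2 * (C n + D n + 1)) ->
  (forall n, D n.+1 = rho2 * D n + K * mu ^+ 2 * (C n + D n + 1)) ->
  (forall n, Y n.+1 = rho1 * Y n + K * (C n + D n + mu ^+ 2)) ->
  exists n0, forall n, (n0 <= n)%N -> 2 * (C n + D n) <= c * mu /\ Y n <= c * mu].
Proof.
move=> a0 K0 /andP[r10 r11] /andP[r20 r21].
(* Fixed points divided by [mu]: [2 * K * mu^2] over [a * mu / 4] for [C + D], then the one of [Y].
   The added 1 is the margin [e = mu] of [affine_eventually]. *)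
pose c1 := 8 * K / a + 1; pose c2 := (K * c1 + K) / (1 - rho1) + 1.
have c10 : 0 <= c1 by rewrite addr_ge0// divr_ge0 ?mulr_ge0// ltW.
have c20 : 0 <= c2 
  by apply: addr_ge0 => //; apply: divr_ge0; [rewrite addr_ge0 ?mulr_ge0|lra].
pose m1 := a / (8 * K + 1); pose m2 := (1 - rho2) / (3 * K + a).
have m10 : 0 < m1 by rewrite divr_gt0//; lra.
have m20 : 0 < m2 by rewrite divr_gt0//; lra.
exists (Num.min (Num.min 1 (1 / a)) (Num.min m1 m2)), (2 * c1 + c2).
split; [by rewrite !lt_min ltr01 m10 m20 divr_gt0|by rewrite addr_ge0// mulr_ge0|].
move=> mu /andP[mu0]; rewrite !lt_min => /andP[/andP[mu1 mua] /andP[mum1 mum2]].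
move=> C D Y C0 D0 CS DS YS.
have a1 : a * mu < 1 by move: mua; rewrite ltr_pdivlMr// mulrC.
have k1 : 8 * (K * mu) <= a.
  move: mum1; rewrite ltr_pdivlMr; last lra.
  by rewrite mulrDr mulr1 => H; lra.
have k2 : 3 * (K * mu) + a * mu <= 1 - rho2.
  move: mum2; rewrite ltr_pdivlMr; last lra.
  by rewrite mulrDr => H; lra.
have Kmu0 : 0 <= K * mu by rewrite mulr_ge0// ltW.
have k3 : K * mu ^+ 2 <= K * mu by rewrite expr2 mulrA ler_piMr// ltW.
have k4 : 8 * (K * mu ^+ 2) <= a * mu.
  by have := ler_wpM2r (ltW mu0) k1; rewrite expr2; lra.
(* The weak coupling [K * mu * D n] is paid for by the contraction of [D], which stays bounded away
   from 1 as [mu] decreases. *)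
have VS n : (0 <= n)%N -> C n.+1 + D n.+1 <=
    (1 - a * mu / 4) * (C n + D n) + 2 * (K * mu ^+ 2).
  move=> _; rewrite CS DS.
  have e1 : 0 <= (a * mu / 4 - 2 * (K * mu ^+ 2)) * C n by rewrite mulr_ge0//; lra.
  have amu : 0 <= a * mu by rewrite mulr_ge0 ?ltW.
  have e2 : 0 <= (1 - a * mu / 4 - rho2 - K * mu - 2 * (K * mu ^+ 2)) * D n.
    by rewrite mulr_ge0//; lra.
  by move: e1 e2; lra.
have amu : 0 < a * mu by exact: mulr_gt0.
have [|n0 n0P] := affine_eventually (r := 1 - a * mu / 4) _ mu0 VS.
  by apply/andP; split; lra.
have {}n0P n : (n0 <= n)%N -> C n + D n <= c1 * mu.
  move=> /n0P /le_trans; apply; rewrite /c1 [leRHS]mulrDl mul1r lerD2r.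
  have -> : 1 - (1 - a * mu / 4) = a * mu / 4 by ring.
  have an : a != 0 by rewrite gt_eqF.
  have mn : mu != 0 by rewrite gt_eqF.
  by rewrite le_eqVlt; apply/orP; left; apply/eqP; field; rewrite ?an ?mn.
have YS' n : (n0 <= n)%N -> Y n.+1 <= rho1 * Y n + (K * c1 + K) * mu.
  move=> /n0P Hn; rewrite YS lerD2l.
  have := ler_wpM2l K0 Hn; move: k3; rewrite !mulrDr mulrDl; lra.
have [|n1 n1P] := affine_eventually (r := rho1) _ mu0 YS'.
  by rewrite r10.
exists (maxn n0 n1) => n; rewrite geq_max => /andP[/n0P H1 /n1P H2].
have c1mu : 0 <= c1 * mu by rewrite mulr_ge0// ltW.
have c2mu : 0 <= c2 * mu by rewrite mulr_ge0// ltW.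
have cE : (2 * c1 + c2) * mu = 2 * (c1 * mu) + c2 * mu by ring.
split; first by rewrite cE; lra.
have E : (K * c1 + K) * mu / (1 - rho1) + mu = c2 * mu by rewrite /c2; field; lra.
by rewrite E in H2; rewrite cE; lra.
Qed.

End Recursions.

(** * Mean-square stability: uniform constants, step-size threshold, iteration of the bounds *)

Theorem theorem1 (R : realType) (M NS NR S Rn : nat)
  (g : 'I_(NS + NR) -> nat) (A : 'M[R]_(NS + NR))
  (p : 'I_(NS + NR) -> R) (tau : 'I_(NS + NR) -> R)
  (J : 'I_(NS + NR) -> 'rV[R]_M -> R) (beta2 sigma2 : 'I_(NS + NR) -> R)
  (* sub-network labelling: group S agents first, then group R agents,
     sub-networks numbered consecutively 0..S+Rn-1, all nonempty *)
  (hgS : forall i : 'I_NS, (g (lshift NR i) < S)%N)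
  (hgR : forall j : 'I_NR, (S <= g (rshift NS j) < S + Rn)%N)
  (hg_onto : forall s, (s < S + Rn)%N -> exists k, g k = s)
  (hg_mono : forall l k : 'I_(NS + NR), (l <= k)%N -> (g l <= g k)%N)
  (* combination matrix: nonnegative, left-stochastic, block structure *)
  (hA_nonneg : forall l k, 0 <= A l k)
  (hA_lstoch : forall k, \sum_(l < NS + NR) A l k = 1)
  (hA_dl : dlsubmx A = 0)
  (hA_SS : forall i j : 'I_NS, g (lshift NR i) <> g (lshift NR j) -> ulsubmx A i j = 0)
  (hA_RR : forall i j : 'I_NR, (g (rshift NS j) < g (rshift NS i))%N -> drsubmx A i j = 0)
  (hA_prim : forall s, (s < S)%N -> primitive_block g A s)
  (hA_irr : forall r, (S <= r < S + Rn)%N ->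
     irreducible_block g A r /\ receives_from_outside g A r)
  (* Perron vectors p_s of the A_s, stacked *)
  (hp_eig : forall s, (s < S)%N -> forall l, g l = s ->
     \sum_(k < NS + NR | g k == s) A l k * p k = p l)
  (hp_sum : forall s, (s < S)%N -> \sum_(k < NS + NR | g k == s) p k = 1)
  (hp_pos : forall k, (g k < S)%N -> 0 < p k)
  (* step-size scalings *)
  (htau : forall k, 0 < tau k <= 1)
  (* costs *)
  (hJ : forall k, convex_fun (J k) /\ twice_diff_bounded_hessian (J k))
  (hJsc : forall s, (s < S)%N -> exists k, g k = s /\ strongly_convex_fun (J k))
  (* gradient-noise constants *)
  (hbeta : forall k, 0 <= beta2 k) (hsigma : forall k, 0 <= sigma2 k) :
  exists mubar : R, 0 < mubar /\ exists c : R,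
  forall mumax : R, 0 < mumax < mubar ->
  forall wS : nat -> 'rV[R]_M,
  (forall s, (s < S)%N ->
     \sum_(k < NS + NR | g k == s) (tau k * mumax * p k) *: grad (J k) (wS s) = 0) ->
  let wstar := diff_limit_point g A wS in
  forall (d : measure_display) (T : measurableType d) (P : probability T R)
    (w : nat -> 'I_(NS + NR) -> T -> 'rV[R]_M)
    (sn : nat -> 'I_(NS + NR) -> T -> 'rV[R]_M),
  (* initial iterates: random vectors with finite second moment *)
  (forall l m, measurable_fun setT (fun x => w 0%N l x ord0 m)) ->
  (forall l, P.-integrable setT (fun x => (sqnorm (w 0%N l x))%:E)) ->
  (* gradient noise s_{k,i+1} (used at step i -> i+1) is a random vector *)
  (forall i l m, measurable_fun setT (fun x => sn i l x ord0 m)) ->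
  (* adapt-then-combine recursion, mu_l = tau_l * mumax *)
  (forall i k x, w i.+1 k x =
     \sum_(l < NS + NR) A l k *:
        (w i l x - (tau l * mumax) *: (grad (J l) (w i l x) + sn i l x))) ->
  (* E[s | F_i] = 0 *)
  (forall i k m, P.-integrable setT (fun x => (sn i k x ord0 m)%:E) /\
     forall E, filtration w i E -> (\int[P]_(x in E) (sn i k x ord0 m)%:E = 0)%E) ->
  (* conditionally uncorrelated noises across agents *)
  (forall i k l, k <> l -> forall m m',
     P.-integrable setT (fun x => (sn i k x ord0 m * sn i l x ord0 m')%:E) /\
     forall E, filtration w i E ->
       (\int[P]_(x in E) (sn i k x ord0 m * sn i l x ord0 m')%:E = 0)%E) ->
  (* E[ ||s||^2 | F_i ] <= beta^2 ||w^* - w||^2 + sigma^2 *)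
  (forall i k E, filtration w i E ->
     (\int[P]_(x in E) (sqnorm (sn i k x))%:E <=
      \int[P]_(x in E) (beta2 k * sqnorm (wstar k - w i k x) + sigma2 k)%:E)%E) ->
  forall k,
    (limn_esup (fun i => \int[P]_x (sqnorm (wstar k - w i k x))%:E) <= (c * mumax)%:E)%E.
Proof.
have [rho1 [u1 [r1 u1S u1R u1c]]] :=
  groupR_potential hgS hgR hA_nonneg hA_lstoch hA_RR hA_irr.
have [rho2 [u2 [r2 u2d u2S u2c]]] :=
  pair_potential hgR hA_nonneg hA_lstoch hA_dl hA_SS hA_prim.
have u2diag k : u2 (k, k) = 0 by apply: u2d; left.
have closed l k := @groupS_closed R NS NR S Rn g A hgR hA_dl hA_SS l k.
have dJ k x : differentiable (J k) x by case: (hJ k) => _ [].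
have [L L0 JL] : exists2 L, 0 <= L & forall k x y,
    sqnorm (grad (J k) x - grad (J k) y) <= L * sqnorm (x - y).
  apply: (@fin_common_bound R _ (fun k L => forall x y,
    sqnorm (grad (J k) x - grad (J k) y) <= L * sqnorm (x - y))) => k.
    by move=> b c bc H x y; apply: le_trans (H x y) _; rewrite ler_wpM2r ?sqnorm_ge0.
  by have [_ /grad_lipschitz] := hJ k.
have cJ k : continuous (grad (J k)).
  by move=> x; apply: differentiable_continuous; have [_ [_ []]] := hJ k.
have tau0 k : 0 < tau k by case/andP: (htau k).
have [a a0 mono] : exists2 a, 0 < a & forall s, (s < S)%N -> forall x y,
    a * sqnorm (x - y) <= \sum_(l < NS + NR | g l == s)
      tau l * p l * dot (x - y) (grad (J l) x - grad (J l) y).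
  have [s b c /andP[_ cb] H x y|s|a a0 aP] := @fin_common_pos R 'I_S (fun s a =>
      forall x y, a * sqnorm (x - y) <= \sum_(l < NS + NR | g l == s)
      tau l * p l * dot (x - y) (grad (J l) x - grad (J l) y)).
  - by apply: le_trans (H x y); rewrite ler_wpM2r ?sqnorm_ge0.
  (* One strongly convex cost suffices: its weight is positive, and the other costs contribute
     nonnegative terms. *)
  - have [k [gk [nu [nu0 sc]]]] := hJsc s (ltn_ord s).
    have pk : 0 < p k by apply: hp_pos; rewrite gk.
    exists (tau k * p k * nu) => [|x y]; first by rewrite !mulr_gt0.
    rewrite (bigD1 k) ?gk//= -[leLHS]addr0; apply: lerD.
      rewrite -mulrA; apply: ler_wpM2l; first by rewrite mulr_ge0// ltW.
      exact: grad_monotone.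
    apply: sumr_ge0 => l /andP[/eqP gl _]; rewrite !mulr_ge0 ?(ltW (tau0 l))//.
      by apply/ltW/hp_pos; rewrite gl.
    by apply: convex_grad_monotone; [case: (hJ l)|exact: dJ].
  - by exists a => // s sS; exact: (aP (Ordinal sS)).
(* Dividing by [mumax] shows that the critical points do not depend on it. *)
have crit mumax (wS : nat -> 'rV[R]_M) s : 0 < mumax ->
    \sum_(k < NS + NR | g k == s) (tau k * mumax * p k) *: grad (J k) (wS s) = 0 ->
    \sum_(k < NS + NR | g k == s) (tau k * p k) *: grad (J k) (wS s) = 0.
  move=> mu0; under eq_bigr do rewrite mulrAC mulrC -scalerA.
  by rewrite -scaler_sumr => /eqP; rewrite scaler_eq0 gt_eqF// => /eqP.
(* The threshold and the constant are chosen before [wS], yet [B] depends on the critical points.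
   These are fixed here as [wS0]; if there are none, the claim is vacuous. *)
have [[wS0 hwS0]|nex] := pselect (exists wS0 : nat -> 'rV[R]_M, forall s, (s < S)%N ->
    \sum_(k < NS + NR | g k == s) (tau k * p k) *: grad (J k) (wS0 s) = 0); last first.
  exists 1; split => //; exists 0 => mumax /andP[mu0 _] wS hwS.
  by exfalso; apply: nex; exists wS => s /hwS; exact: crit.
pose ws := diff_limit_point g A wS0.
have wsS k : (g k < S)%N -> ws k = wS0 (g k).
  rewrite /ws; case: (split_ordP k) => i ->; first by rewrite diff_limit_point_lshift.
  by rewrite ltnNge; have /andP[-> _] := hgR i.
have harm k : ws k = \sum_l A l k *: ws l := limit_point_harmonic hgS hgR hA_nonneg
  hA_lstoch hA_dl hA_SS hA_RR hA_irr wS0 k.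
pose B := \sum_k sqnorm (grad (J k) (ws k)).
pose beta := \sum_k beta2 k.
pose sigma := \sum_k sigma2 k.
have le_sum (F : 'I_(NS + NR) -> R) k : (forall l, 0 <= F l) -> F k <= \sum_l F l.
  by move=> F0; rewrite (bigD1 k)//= lerDl; apply: sumr_ge0.
have B0 : 0 <= B by apply: sumr_ge0 => k _; exact: sqnorm_ge0.
have Bb k : sqnorm (grad (J k) (ws k)) <= B.
  by apply: (le_sum (fun k => sqnorm (grad (J k) (ws k)))) => l; exact: sqnorm_ge0.
have beta0 : 0 <= beta by exact: sumr_ge0.
have sigma0 : 0 <= sigma by exact: sumr_ge0.
have Kg0 : 0 <= Kg L B beta sigma by exact: Kg_ge0.
have t1p : 0 < t1 rho1 by exact: t1_gt0.
pose k1 := (1 + (t1 rho1)^-1) * Kg L B beta sigma.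
have k10 : 0 <= k1 by rewrite mulr_ge0// addr_ge0// invr_ge0 ltW.
have K0 : 0 <= K L a B beta sigma rho1 rho2 by exact: K_ge0.
have [||mub [c [mub0 c0 rec]]] := @coupled_recursion R a (K L a B beta sigma rho1 rho2)
   ((1 + rho1) / 2) ((1 + rho2) / 2) a0 K0.
- by case/andP: r1 => ? ?; apply/andP; split; lra.
- by case/andP: r2 => ? ?; apply/andP; split; lra.
(* One term for each smallness condition of the one-step analysis, plus [mub] for the scalar
   recursion; the added 1s keep denominators positive. *)
pose mubar := Num.min (Num.min mub 1) (Num.min (Num.min (a / (L + 1)) (1 / a)) (t1 rho1 / (k1 + 1))).
exists mubar; split.
  by rewrite !lt_min mub0 ltr01 !divr_gt0//; lra.
exists (2 * c) => mumax /andP[mu0]; rewrite !lt_min.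
move=> /andP[/andP[mulb mul1] /andP[/andP[mulL mula] mulK]].
have muL : mumax * L <= a.
  move: mulL; rewrite ltr_pdivlMr; last lra.
  by rewrite mulrDr mulr1; lra.
have mua : a * mumax <= 1 by move: mula; rewrite ltr_pdivlMr// mulrC => /ltW.
have muK : (1 + (t1 rho1)^-1) * mumax ^+ 2 * Kg L B beta sigma <= t1 rho1.
  move: mulK; rewrite ltr_pdivlMr; last lra.
  rewrite mulrDr mulr1 => H.
  have -> : (1 + (t1 rho1)^-1) * mumax ^+ 2 * Kg L B beta sigma = mumax * (mumax * k1).
    by rewrite /k1; ring.
  have Z : 0 <= mumax * k1 by rewrite mulr_ge0// ltW.
  have : mumax * (mumax * k1) <= mumax * k1 by rewrite ler_piMl// ltW.
  lra.
move=> wS hwS wstar d T P w sn mw0 iw0 msn wE sn0 _ mom k.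
(* Strong monotonicity of the aggregate gradient makes the critical point unique. *)
have wSE s : (s < S)%N -> wS s = wS0 s.
  move=> sS; apply/eqP; rewrite -subr_eq0; apply/eqP; apply: sqnorm_eq0.
  rewrite -(pmulr_rle0 _ a0); apply: le_trans (mono s sS _ _) _.
  have e1 := crit _ _ _ mu0 (hwS s sS); have e2 := hwS0 s sS.
  set x := wS s - wS0 s.
  rewrite (_ : \sum_(l < _ | _) _ = dot x
      (\sum_(l | g l == s) (tau l * p l) *: grad (J l) (wS s) -
       \sum_(l | g l == s) (tau l * p l) *: grad (J l) (wS0 s))).
    by rewrite e1 e2 subrr dot0r.
  rewrite -sumrB big_mkcond [in RHS]big_mkcond dot_sumr; apply: eq_bigr => l _.
  by case: ifP => _; rewrite ?dot0r// -scalerBr dotZr.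
have wstarE : wstar = ws.
  apply/funext => l; rewrite /wstar /ws; case: (split_ordP l) => i ->.
    by rewrite !diff_limit_point_lshift; exact: wSE.
  by rewrite !diff_limit_point_rshift; apply: eq_bigr => j _; rewrite wSE.
rewrite wstarE in mom *.
have mw i : forall l, rvec (w i l).
  elim: i => [|i IH] l; first exact: mw0.
  rewrite (_ : w i.+1 l = fun x => \sum_h A h l *:
     (w i h x - (tau h * mumax) *: (grad (J h) (w i h x) + sn i h x))).
    apply: rvec_sum => h; apply: rvecZ; apply: rvecB => //; apply: rvecZ.
    by apply: rvecD; [exact: rvec_comp|exact: msn].
  by apply/funext => x; exact: wE.
pose G i := [set E | exists j l m (C : set R),
  (j <= i)%N /\ measurable C /\ E = (fun x => w j l x ord0 m) @^-1` C].
have GT i E : G i E -> measurable E.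
  move=> [j [l [m [C [_ [mC ->]]]]]].
  by rewrite -[X in measurable X]setTI; exact: mw.
have Gw i l : @rvec R M _ (g_sigma_algebraType (G i)) (w i l).
  move=> m _ C mC; rewrite setTI; apply: sub_sigma_algebra.
  by exists i, l, m, C.
(* The conditional moment bound integrated over the whole space, with constants common to all
   agents. *)
have mom' i l m : Ebnd P (fun x => sqnorm (ws l - w i l x)) m ->
    Ebnd P (fun x => sqnorm (sn i l x)) (beta * m + sigma).
  move=> hm; have m0 := Ebnd_ge0 hm.
  have H := EbndD (EbndZ (hbeta l) hm) (Ebnd_cst P (hsigma l)).
  split; [exact/measurable_sqnorm/msn|by move=> x; exact: sqnorm_ge0|].
  have FT : filtration w i setT by exact: (@measurableT _ (g_sigma_algebraType (G i))).
  apply: le_trans (mom i l setT FT) _; case: H => _ _ /le_trans; apply.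
  rewrite lee_fin; apply: lerD; last exact: le_sum.
  by rewrite ler_wpM2r// le_sum.
have [m0 m00 hm0] : exists2 m, 0 <= m & forall l, Ebnd P (fun x => sqnorm (w 0%N l x)) m.
  apply: (@fin_common_bound R _ (fun l m => Ebnd P (fun x => sqnorm (w 0%N l x)) m)) => l.
    by move=> b e; exact: EbndW.
  have fin := integrable_fin_num measurableT (iw0 l).
  exists (fine (\int[P]_x (sqnorm (w 0%N l x))%:E)).
    by rewrite fine_ge0// integral_ge0// => x _; rewrite lee_fin sqnorm_ge0.
  split; [exact/measurable_sqnorm/mw|by move=> x; exact: sqnorm_ge0|].
  by rewrite fineK.
have [C0 [D0 [Y0 [C00 D00 Y00 st0]]]] :=
  state_init hp_sum hp_pos wS0 ws u1R u2diag u2S (mw 0%N) m00 hm0.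
pose KK := K L a B beta sigma rho1 rho2.
(* The bounds follow the recursion with equality, whatever the actual moments; [state_next] keeps
   them valid. *)
pose next (t : R * R * R) : R * R * R :=
  ((1 - a * mumax / 2) * t.1.1 + KK * mumax * t.1.2 + KK * mumax ^+ 2 * (t.1.1 + t.1.2 + 1),
   (1 + rho2) / 2 * t.1.2 + KK * mumax ^+ 2 * (t.1.1 + t.1.2 + 1),
   (1 + rho1) / 2 * t.2 + KK * (t.1.1 + t.1.2 + mumax ^+ 2)).
pose z n := iter n next (C0, D0, Y0).
have zP n : [/\ 0 <= (z n).1.1, 0 <= (z n).1.2, 0 <= (z n).2 &
    state S g p wS0 ws u1 u2 P (w n) (z n).1.1 (z n).1.2 (z n).2].
  elim: n => [//|n [Cn Dn Yn stn]].
  have [/andP[r10 _] /andP[r20 _]] := (r1, r2).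
  have mu2 := sqr_ge0 mumax; have mu0' := ltW mu0.
  have a2 : 0 <= 1 - a * mumax / 2 by lra.
  have r1' : 0 <= (1 + rho1) / 2 by lra.
  have r2' : 0 <= (1 + rho2) / 2 by lra.
  have CDn : 0 <= (z n).1.1 + (z n).1.2 by exact: addr_ge0.
  have KK2 : 0 <= KK * mumax ^+ 2 * ((z n).1.1 + (z n).1.2 + 1).
    by apply: mulr_ge0; [exact: mulr_ge0|exact: addr_ge0].
  have n1 : 0 <= (next (z n)).1.1.
    exact: (addr_ge0 (addr_ge0 (mulr_ge0 a2 Cn) (mulr_ge0 (mulr_ge0 K0 mu0') Dn)) KK2).
  have n2 : 0 <= (next (z n)).1.2 by exact: (addr_ge0 (mulr_ge0 r2' Dn) KK2).
  have n3 : 0 <= (next (z n)).2.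
    exact: (addr_ge0 (mulr_ge0 r1' Yn) (mulr_ge0 K0 (addr_ge0 CDn mu2))).
  split; [exact: n1|exact: n2|exact: n3|].
  exact: (state_next hA_nonneg hA_lstoch closed hp_eig hp_sum hp_pos htau L0 JL cJ a0 mono
    wsS harm hwS0 Bb B0 beta0 sigma0 r1 u1R u1S u1c r2 u2diag u2S u2c mu0 (ltW mul1)
    muL mua muK (GT n) (Gw n) (fun l m => (sn0 n l m).1) (fun l m => (sn0 n l m).2)
    (mom' n) (wE n) Cn Dn Yn stn).
have mumub : 0 < mumax < mub by rewrite mu0.
have zC n : 0 <= (z n).1.1 by case: (zP n).
have zD n : 0 <= (z n).1.2 by case: (zP n).
have [n0 n0P] := rec mumax mumub (fun n => (z n).1.1) (fun n => (z n).1.2)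
  (fun n => (z n).2) zC zD (fun=> erefl) (fun=> erefl) (fun=> erefl).
apply: (@limn_esup_le_eventually _ _ _ n0) => n /n0P[H1 H2].
have [Cn Dn Yn stn] := zP n.
have [_ _ /le_trans] := Ebnd_err hp_sum hp_pos wsS u1S u2diag u2S Cn Dn stn k.
apply; rewrite lee_fin.
have uY : (z n).2 * u1 k <= (z n).2.
  rewrite ler_piMr//; have [gk|gk] := ltnP (g k) S; first by rewrite u1S.
  by case/andP: (u1R k gk).
have -> : 2 * c * mumax = c * mumax + c * mumax by ring.
by apply: lerD => //; exact: le_trans H2.
Qed.
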